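(* Let $n\geq 2$ be an integer and let $G$ be a finitely generated group. Then: (1) The $n$-fold tensor product $G^{\otimes n}$ is finite if and only if $G$ is finite. (2) The $n$-fold tensor product $G^{\otimes n}$ is polycyclic if and only if $G$ is polycyclic.
   Context: Conventions: actions are on the right, $x^y = y^{-1}xy$, $[x,y]=x^{-1}y^{-1}xy = x^{-1}x^y$, and longer commutators are left-normed: $[x_1,\dots,x_k]=[[x_1,\dots,x_{k-1}],x_k]$. Two groups $G$ and $H$, each acting on the other on the right and on itself by conjugation, act compatibly if for all $g,g_1\in G$, $h,h_1\in H$: $g^{(h^{g_1})} = ((g^{g_1^{-1}})^h)^{g_1}$ and $h^{(g^{h_1})} = ((h^{h_1^{-1}})^g)^{h_1}$. In that case the non-abelian tensor product $G\otimes H$ is the group generated by symbols $g\otimes h$ ($g\in G$, $h\in H$) subject to the relations $gg_1\otimes h = (g^{g_1}\otimes h^{g_1})(g_1\otimes h)$ and $g\otimes hh_1 = (g\otimes h_1)(g^{h_1}\otimes h^{h_1})$ for all $g,g_1\in G$, $h,h_1\in H$. The $n$-fold tensor product $G^{\otimes n}$ is defined inductively. $G^{\otimes 2}=G\otimes G$ is the non-abelian tensor product of $G$ with itself, all actions being conjugation. For $n\geq 3$, $G^{\otimes n} = G^{\otimes (n-1)}\otimes G$, where $G$ acts on $G^{\otimes (n-1)}$ diagonally, $(((g_1\otimes g_2)\otimes\dots)\otimes g_{n-1})^{g} = ((g_1^{g}\otimes g_2^{g})\otimes\dots)\otimes g_{n-1}^{g}$, and $G^{\otimes(n-1)}$ acts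 on $G$ by $g^{((g_2\otimes g_3)\otimes\dots)\otimes g_n} = g^{[g_2,g_3,\dots,g_n]}$. These actions are well defined and compatible. *)

(* Defs.v *)
From HB Require Import structures.
From mathcomp Require Import all_boot all_classical.

Set Implicit Arguments.
Unset Strict Implicit.
Unset Printing Implicit Defensive.

Local Open Scope classical_set_scope.
Local Open Scope group_scope.
Local Open Scope quotient_scope.

Section Subgroups.
Variable G : groupType.
Implicit Types (A H K : set G).

Definition is_subgroup A : Prop :=
  [/\ A 1, forall x y, A x -> A y -> A (x * y) & forall x, A x -> A x^-1].

Definition generated A : set G := smallest is_subgroup A.

Definition finitely_generated : Prop :=
  exists2 A : set G, finite_set A & generated A = setT.

Definition is_normal_in H K : Prop :=
  [/\ is_subgroup H, is_subgroup K, H `<=` K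
    & forall x y, H x -> K y -> H (x ^ y)].

(* For H normal in K, this says that the quotient K / H is cyclic: every coset
   y H with y in K is the n-th power of x H for some integer n, written here as
   x ^+ n or x ^- n with n a natural number. *)
Definition has_cyclic_quotient H K : Prop :=
  exists2 x, K x &
    forall y, K y -> exists n : nat, H ((x ^+ n)^-1 * y) \/ H ((x ^- n)^-1 * y).

Definition polycyclic : Prop :=
  exists (m : nat) (s : nat -> set G),
    [/\ s 0 = [set 1], s m = setT
      & forall i, i < m ->
          is_normal_in (s i) (s i.+1) /\ has_cyclic_quotient (s i) (s i.+1)].

End Subgroups.

Arguments finitely_generated : clear implicits.
Arguments polycyclic : clear implicits.

Section Presentation.
Variable X : choiceType.

(* The letter (x, false) stands for x, and (x, true) for its inverse. *)
Definition word : Type := seq (X * bool).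

Variable R : word -> word -> Prop.

Inductive pres_eq : word -> word -> Prop :=
| pres_eq_refl u : pres_eq u u
| pres_eq_sym u v : pres_eq u v -> pres_eq v u
| pres_eq_trans u v w : pres_eq u v -> pres_eq v w -> pres_eq u w
| pres_eq_cat u v u' v' :
    pres_eq u v -> pres_eq u' v' -> pres_eq (u ++ u') (v ++ v')
| pres_eq_cancel x b : pres_eq [:: (x, b); (x, ~~ b)] [::]
| pres_eq_rel u v : R u v -> pres_eq u v.

Definition pres_rel : rel (seq (X * bool)) := fun u v => `[< pres_eq u v >].

Lemma pres_rel_refl : reflexive pres_rel.
Proof. by move=> u; apply/asboolP; exact: pres_eq_refl. Qed.

Lemma pres_rel_sym : symmetric pres_rel.
Proof. by move=> u v; apply/asboolP/asboolP; exact: pres_eq_sym. Qed.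

Lemma pres_rel_trans : transitive pres_rel.
Proof.
move=> v u w /asboolP uv /asboolP vw; apply/asboolP; exact: pres_eq_trans vw.
Qed.

Canonical pres_equiv_rel :=
  EquivRel pres_rel pres_rel_refl pres_rel_sym pres_rel_trans.

Definition presented : Type := {eq_quot pres_equiv_rel}.
HB.instance Definition _ := Choice.on presented.

Definition pres_class (u : word) : presented := \pi_({eq_quot pres_equiv_rel}) u.
Definition pres_word (a : presented) : word := repr a.

Lemma pres_wordK a : pres_class (pres_word a) = a.
Proof. exact: reprK. Qed.

Lemma pres_classP u v : pres_class u = pres_class v <-> pres_eq u v.
Proof. by split=> [/eqmodP/asboolP|uv] //; apply/eqmodP/asboolP. Qed.

Lemma pres_classK u : pres_eq (pres_word (pres_class u)) u.
Proof. by apply/pres_classP; rewrite pres_wordK. Qed.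

Definition word_inv (u : word) : word := rev [seq (l.1, ~~ l.2) | l <- u].

Lemma word_invK u : word_inv (word_inv u) = u.
Proof.
rewrite /word_inv map_rev revK -map_comp map_id_in // => -[x b] _ /=.
by rewrite negbK.
Qed.

Lemma word_inv_cat u v : word_inv (u ++ v) = word_inv v ++ word_inv u.
Proof. by rewrite /word_inv map_cat rev_cat. Qed.

Lemma word_mulV u : pres_eq (u ++ word_inv u) [::].
Proof.
elim: u => [|[x b] u IH]; first exact: pres_eq_refl.
rewrite -cat1s word_inv_cat -catA (catA u).
apply: (@pres_eq_trans _ ([:: (x, b)] ++ ([::] ++ word_inv [:: (x, b)]))).
  apply: pres_eq_cat; first exact: pres_eq_refl.
  by apply: pres_eq_cat => //; exact: pres_eq_refl.
exact: pres_eq_cancel.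
Qed.

Lemma word_Vmul u : pres_eq (word_inv u ++ u) [::].
Proof. by rewrite -{2}(word_invK u); exact: word_mulV. Qed.

Lemma word_inv_eq u v : pres_eq u v -> pres_eq (word_inv u) (word_inv v).
Proof.
move=> uv; apply: (@pres_eq_trans _ (word_inv u ++ (v ++ word_inv v))).
  rewrite -{1}(cats0 (word_inv u)).
  apply: pres_eq_cat; first exact: pres_eq_refl.
  by apply: pres_eq_sym; exact: word_mulV.
rewrite catA -{2}(cat0s (word_inv v)).
apply: pres_eq_cat; last exact: pres_eq_refl.
apply: pres_eq_trans (word_Vmul u).
by apply: pres_eq_cat; [exact: pres_eq_refl | exact: pres_eq_sym].
Qed.

Definition pres_one : presented := pres_class [::].
Definition pres_mul (a b : presented) : presented :=
  pres_class (pres_word a ++ pres_word b).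
Definition pres_inv (a : presented) : presented :=
  pres_class (word_inv (pres_word a)).

Lemma pres_mul_class u v :
  pres_mul (pres_class u) (pres_class v) = pres_class (u ++ v).
Proof. by apply/pres_classP; apply: pres_eq_cat; exact: pres_classK. Qed.

Lemma pres_inv_class u : pres_inv (pres_class u) = pres_class (word_inv u).
Proof. by apply/pres_classP; apply: word_inv_eq; exact: pres_classK. Qed.

Lemma pres_mulA : associative pres_mul.
Proof.
move=> a b c; rewrite -[a]pres_wordK -[b]pres_wordK -[c]pres_wordK.
by rewrite !pres_mul_class catA.
Qed.

Lemma pres_mul1 : left_id pres_one pres_mul.
Proof. by move=> a; rewrite -[a]pres_wordK pres_mul_class. Qed.

Lemma pres_mulr1 : right_id pres_one pres_mul.
Proof. by move=> a; rewrite -[a]pres_wordK pres_mul_class cats0. Qed.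

Lemma pres_mulV : left_inverse pres_one pres_inv pres_mul.
Proof.
move=> a; rewrite -[a]pres_wordK pres_inv_class pres_mul_class.
by apply/pres_classP; exact: word_Vmul.
Qed.

Lemma pres_mulrV : right_inverse pres_one pres_inv pres_mul.
Proof.
move=> a; rewrite -[a]pres_wordK pres_inv_class pres_mul_class.
by apply/pres_classP; exact: word_mulV.
Qed.

HB.instance Definition _ := isGroup.Build presented
  pres_mulA pres_mul1 pres_mulr1 pres_mulV pres_mulrV.

Definition pres_gen (x : X) : presented := pres_class [:: (x, false)].

Lemma pres_classM u v : pres_class (u ++ v) = pres_class u * pres_class v.
Proof. by rewrite -pres_mul_class. Qed.

Lemma pres_genV x : pres_class [:: (x, true)] = (pres_gen x)^-1.
Proof. by rewrite -[RHS]/(pres_inv _) pres_inv_class. Qed.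

Lemma pres_ind (P : presented -> Prop) :
  P 1 -> (forall x a, P a -> P (pres_gen x * a)) ->
  (forall x a, P a -> P ((pres_gen x)^-1 * a)) -> forall a, P a.
Proof.
move=> P1 PM PV a; rewrite -[a]pres_wordK.
elim: (pres_word a) => [//|[x b] u IH].
rewrite -cat1s pres_classM; case: b; last exact: PM.
by rewrite pres_genV; exact: PV.
Qed.

Section Lift.
Variables (K : groupType) (f : X -> K).

Definition word_eval (u : word) : K :=
  foldr (fun l a => (if l.2 then (f l.1)^-1 else f l.1) * a) 1 u.

Lemma word_eval_cat u v : word_eval (u ++ v) = word_eval u * word_eval v.
Proof. by elim: u => [|l u IH] /=; rewrite ?mul1g // IH mulgA. Qed.

Hypothesis fR : forall u v, R u v -> word_eval u = word_eval v.

Lemma word_eval_eq u v : pres_eq u v -> word_eval u = word_eval v.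
Proof.
elim=> {u v} //.
- by move=> u v w _ -> _ ->.
- by move=> u v u' v' _ e _ e'; rewrite !word_eval_cat e e'.
by move=> x [] /=; rewrite mulg1 ?mulgV ?mulVg.
Qed.

Definition pres_lift (a : presented) : K := word_eval (pres_word a).

Lemma pres_lift_gen x : pres_lift (pres_gen x) = f x.
Proof. by rewrite /pres_lift (word_eval_eq (pres_classK _)) /= mulg1. Qed.

Lemma pres_liftM a b : pres_lift (a * b) = pres_lift a * pres_lift b.
Proof.
by rewrite /pres_lift (word_eval_eq (pres_classK _)) word_eval_cat.
Qed.

End Lift.
End Presentation.

Section Tensor.

Definition is_right_action (G H : groupType) (act : G -> H -> G) : Prop :=
  [/\ forall g, act g 1 = g,
      forall g h h1, act g (h * h1) = act (act g h) h1
    & forall g g1 h, act (g * g1) h = act g h * act g1 h].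

Record compatible_actions (G H : groupType) := CompatibleActions {
  actl : G -> H -> G;
  actr : H -> G -> H;
  actl_action : is_right_action actl;
  actr_action : is_right_action actr;
  actl_compat : forall g g1 h,
    actl g (actr h g1) = actl (g ^ g1^-1) h ^ g1;
  actr_compat : forall h h1 g,
    actr h (actl g h1) = actr (h ^ h1^-1) g ^ h1 }.

Variables (G H : groupType) (c : compatible_actions G H).

Inductive tensor_rel : word (G * H)%type -> word (G * H)%type -> Prop :=
| tensor_rel_l g g1 h : tensor_rel
    [:: ((g * g1, h), false)]
    [:: ((g ^ g1, actr c h g1), false); ((g1, h), false)]
| tensor_rel_r g h h1 : tensor_rel
    [:: ((g, h * h1), false)]
    [:: ((g, h1), false); ((actl c g h1, h ^ h1), false)].

Definition tensor : groupType := presented tensor_rel.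

Definition tens (g : G) (h : H) : tensor := pres_gen tensor_rel (g, h).

Lemma tensMl g g1 h :
  tens (g * g1) h = tens (g ^ g1) (actr c h g1) * tens g1 h.
Proof.
rewrite -[RHS]pres_classM; apply/pres_classP/pres_eq_rel.
exact: tensor_rel_l.
Qed.

Lemma tensMr g h h1 :
  tens g (h * h1) = tens g h1 * tens (actl c g h1) (h ^ h1).
Proof.
rewrite -[RHS]pres_classM; apply/pres_classP/pres_eq_rel.
exact: tensor_rel_r.
Qed.

Lemma tensor_ind (P : tensor -> Prop) :
  P 1 -> (forall g h a, P a -> P (tens g h * a)) ->
  (forall g h a, P a -> P ((tens g h)^-1 * a)) -> forall a, P a.
Proof.
by move=> P1 PM PV; apply: pres_ind => [//|[g h]|[g h]]; [exact: PM | exact: PV].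
Qed.

Section TensorLift.
Variables (K : groupType) (f : G -> H -> K).

Definition tensor_lift : tensor -> K := pres_lift (fun p => f p.1 p.2).

Hypothesis fl :
  forall g g1 h, f (g * g1) h = f (g ^ g1) (actr c h g1) * f g1 h.
Hypothesis fr :
  forall g h h1, f g (h * h1) = f g h1 * f (actl c g h1) (h ^ h1).

Lemma tensor_lift_rel u v : tensor_rel u v ->
  word_eval (fun p => f p.1 p.2) u = word_eval (fun p => f p.1 p.2) v.
Proof. by case=> [g g1 h|g h h1] /=; rewrite !mulg1. Qed.

Lemma tensor_lift_tens g h : tensor_lift (tens g h) = f g h.
Proof. exact: (pres_lift_gen tensor_lift_rel). Qed.

Lemma tensor_liftM a b : tensor_lift (a * b) = tensor_lift a * tensor_lift b.
Proof. exact: (pres_liftM tensor_lift_rel). Qed.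

End TensorLift.
End Tensor.

Section Morphism.
Variables (T K : groupType) (f : T -> K).
Hypothesis fM : forall a b, f (a * b) = f a * f b.

Lemma morph1 : f 1 = 1.
Proof. by apply: (mulgI (f 1)); rewrite -fM !mulg1. Qed.

Lemma morphV a : f a^-1 = (f a)^-1.
Proof. by apply: (mulgI (f a)); rewrite -fM !mulgV morph1. Qed.

Lemma morphJ a b : f (a ^ b) = f a ^ f b.
Proof. by rewrite !conjgE !fM morphV. Qed.

End Morphism.

Section TensorPower.
Variable G : groupType.

(* A group T carrying what is needed to form T ⊗ G in the inductive definition
   of the tensor powers of G: the right action of G on T, and the homomorphism
   T -> G through which T acts on G by conjugation.  For T = G^{⊗k} this
   homomorphism is g_1 ⊗ ... ⊗ g_k |-> [g_1, ..., g_k]; see tpow_map_pure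
   below. *)
Record power_datum := PowerDatum {
  pd_group :> groupType;
  pd_act : pd_group -> G -> pd_group;
  pd_map : pd_group -> G;
  pd_action : is_right_action pd_act;
  pd_mapM : forall t t1, pd_map (t * t1) = pd_map t * pd_map t1;
  pd_map_act : forall t x, pd_map (pd_act t x) = pd_map t ^ x;
  pd_act_map : forall t t1, pd_act t (pd_map t1) = t ^ t1 }.

Lemma conj_action : is_right_action (@conjg G).
Proof.
by split=> *; [exact: conjg1 | exact: conjgM | exact: conjMg].
Qed.

Definition pd1 : power_datum :=
  @PowerDatum G (@conjg G) id conj_action
    (fun _ _ => erefl) (fun _ _ => erefl) (fun _ _ => erefl).

Section Step.
Variable T : power_datum.
Implicit Types (t : T) (g x : G).

Notation act := (@pd_act T).
Notation lam := (@pd_map T).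

Let act1 t : act t 1 = t. Proof. by case: (pd_action T). Qed.
Let actM t g x : act t (g * x) = act (act t g) x.
Proof. by case: (pd_action T). Qed.
Let actMl t t1 x : act (t * t1) x = act t x * act t1 x.
Proof. by case: (pd_action T). Qed.
Let lamM : forall t t1, lam (t * t1) = lam t * lam t1 := @pd_mapM T.
Let actJ t t1 x : act (t ^ t1) x = act t x ^ act t1 x.
Proof. exact: (@morphJ _ _ (act^~ x)). Qed.

Lemma step_actr_action : is_right_action (fun g t => g ^ lam t).
Proof.
split=> [g|g t t1|g g1 t].
- by rewrite (morph1 lamM) conjg1.
- by rewrite lamM conjgM.
exact: conjMg.
Qed.

Lemma step_actl_compat t t1 g :
  act t (g ^ lam t1) = act (t ^ t1^-1) g ^ t1.
Proof. by rewrite -!pd_act_map (morphV lamM) conjgE !actM. Qed.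

Lemma step_actr_compat g g1 t :
  g ^ lam (act t g1) = ((g ^ g1^-1) ^ lam t) ^ g1.
Proof. by rewrite pd_map_act -!conjgM conjgE. Qed.

Definition step_actions : compatible_actions T G :=
  CompatibleActions (pd_action T) step_actr_action
    step_actl_compat step_actr_compat.

Notation S := (tensor step_actions).
Notation tns := (tens step_actions).

Definition step_act (a : S) (x : G) : S :=
  tensor_lift (fun t g => tns (act t x) (g ^ x)) a.

Definition step_map (a : S) : G :=
  tensor_lift (fun t g => [~ lam t, g]) a.

Lemma step_act_l x t t1 g :
  tns (act (t * t1) x) (g ^ x) =
  tns (act (t ^ t1) x) (actr step_actions g t1 ^ x) * tns (act t1 x) (g ^ x).
Proof. by rewrite actMl tensMl actJ /= pd_map_act -conjJg. Qed.

Lemma step_act_r x t g g1 :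
  tns (act t x) ((g * g1) ^ x) =
  tns (act t x) (g1 ^ x) * tns (act (actl step_actions t g1) x) ((g ^ g1) ^ x).
Proof. by rewrite conjMg tensMr /= -conjJg -!actM -(conjgC g1 x). Qed.

Lemma step_map_l t t1 g :
  [~ lam (t * t1), g] =
  [~ lam (t ^ t1), actr step_actions g t1] * [~ lam t1, g].
Proof.
rewrite /= (morphJ lamM) -conjRg lamM !commgEl !conjgE !invgM ?invgK.
by rewrite !gnorm.
Qed.

Lemma step_map_r t g g1 :
  [~ lam t, g * g1] =
  [~ lam t, g1] * [~ lam (actl step_actions t g1), g ^ g1].
Proof.
rewrite /= pd_map_act -conjRg !commgEl !conjgE !invgM ?invgK.
by rewrite !gnorm.
Qed.

Lemma step_act_tens t g x : step_act (tns t g) x = tns (act t x) (g ^ x).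
Proof. by rewrite /step_act (tensor_lift_tens (step_act_l x) (step_act_r x)). Qed.

Lemma step_actMl a b x : step_act (a * b) x = step_act a x * step_act b x.
Proof. exact: (tensor_liftM (step_act_l x) (step_act_r x)). Qed.

Lemma step_map_tens t g : step_map (tns t g) = [~ lam t, g].
Proof. exact: (tensor_lift_tens step_map_l step_map_r). Qed.

Lemma step_mapM a b : step_map (a * b) = step_map a * step_map b.
Proof. exact: (tensor_liftM step_map_l step_map_r). Qed.

Lemma step_ext (K : groupType) (f h : S -> K) :
  (forall a b, f (a * b) = f a * f b) -> (forall a b, h (a * b) = h a * h b) ->
  (forall t g, f (tns t g) = h (tns t g)) -> forall a, f a = h a.
Proof.
move=> fM hM fh; elim/tensor_ind => [|t g a IH|t g a IH].
- by rewrite (morph1 fM) (morph1 hM).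
- by rewrite fM hM fh IH.
by rewrite fM hM (morphV fM) (morphV hM) fh IH.
Qed.

Lemma step_action : is_right_action step_act.
Proof.
split=> [a|a x y|a b x]; last exact: step_actMl.
- apply: (@step_ext _ (step_act^~ 1) id) => // [b c|t g].
    exact: step_actMl.
  by rewrite step_act_tens act1 conjg1.
- apply: (@step_ext _ (step_act^~ (x * y)) (fun a => step_act (step_act a x) y)).
  + by move=> b c; rewrite step_actMl.
  + by move=> b c; rewrite !step_actMl.
  by move=> t g; rewrite !step_act_tens actM conjgM.
Qed.

Lemma step_map_act a x : step_map (step_act a x) = step_map a ^ x.
Proof.
apply: (@step_ext _ (fun a => step_map (step_act a x)) (fun a => step_map a ^ x)).
- by move=> b c; rewrite step_actMl step_mapM.
- by move=> b c; rewrite step_mapM conjMg.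
by move=> t g; rewrite step_act_tens !step_map_tens pd_map_act conjRg.
Qed.

Lemma step_swap t g t1 g1 :
  step_act (tns t g) (g1 * lam t1) * tns t1 g1 =
  tns t1 g1 * step_act (tns t g) (lam t1 * g1).
Proof.
have Ml t2 t3 g2 :
    tns (t2 * t3) g2 = step_act (tns t2 g2) (lam t3) * tns t3 g2.
  by rewrite tensMl step_act_tens pd_act_map.
have Mr t2 g2 g3 :
    tns t2 (g2 * g3) = tns t2 g3 * step_act (tns t2 g2) g3.
  by rewrite tensMr step_act_tens.
have [_ sM _] := step_action.
have := Ml t t1 (g * g1).
rewrite !Mr !Ml !step_actMl -!sM -!mulgA => /mulgI.
by rewrite !mulgA => /mulIg ->.
Qed.

Lemma step_act_map a b : step_act a (step_map b) = a ^ b.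
Proof.
have [s1 sM _] := step_action.
have sJ t1 g1 a' : step_act a' (step_map (tns t1 g1)) = a' ^ tns t1 g1.
  apply: (@step_ext _ (step_act^~ _) (conjg^~ (tns t1 g1))) => [||t g].
  - by move=> c d; rewrite step_actMl.
  - by move=> c d; rewrite conjMg.
  pose y := (g1 * lam t1)^-1.
  have := step_swap (act t y) (g ^ y) t1 g1.
  rewrite -step_act_tens -!sM mulVg s1 => e.
  rewrite conjgE e mulKg step_map_tens commgEl conjgE; congr step_act.
  by rewrite /y invgM !mulgA.
elim/tensor_ind: b a => [a|t1 g1 b IH a|t1 g1 b IH a].
- by rewrite (morph1 step_mapM) s1 conjg1.
- by rewrite step_mapM sM IH sJ conjgM.
rewrite step_mapM sM IH conjgM; congr (_ ^ _).
apply: (@conjg_inj _ (tns t1 g1)); rewrite -sJ -sM (morphV step_mapM) mulVg s1.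
by rewrite -conjgM mulVg conjg1.
Qed.

Definition pd_step : power_datum :=
  PowerDatum step_action step_mapM step_map_act step_act_map.

End Step.

Fixpoint tpow_succ (k : nat) : power_datum :=
  if k is k'.+1 then pd_step (tpow_succ k') else pd1.

(* The iterated pure tensor ((g_0 ⊗ g_1) ⊗ ...) ⊗ g_k. *)
Fixpoint tpow_pure (g : nat -> G) (k : nat) : tpow_succ k :=
  if k is k'.+1 return tpow_succ k
  then tens (step_actions (tpow_succ k')) (tpow_pure g k') (g k) else g 0.

Fixpoint left_normed_commutator (g : nat -> G) (k : nat) : G :=
  if k is k'.+1 then [~ left_normed_commutator g k', g k] else g 0.

Lemma tpow_act_pure g k x :
  pd_act (tpow_pure g k) x = tpow_pure (fun i => g i ^ x) k.
Proof. by elim: k => [//|k IH] /=; rewrite step_act_tens IH. Qed.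

Lemma tpow_map_pure g k :
  pd_map (tpow_pure g k) = left_normed_commutator g k.
Proof. by elim: k => [//|k IH] /=; rewrite step_map_tens IH. Qed.

End TensorPower.

(* tpow_succ G k is the (k+1)-fold tensor product, hence the shift; the value
   at n = 0 is a dummy. *)
Definition tensor_power (G : groupType) (n : nat) : groupType :=
  tpow_succ G n.-1.

(* Main.v *)
(* For a crossed module lam : T -> G, such as each tensor power of G with its
   commutator map, write N = [lam T, G] for the image of S = T ⊗ G -> G.  The
   kernel of S -> N is central, since S acts on itself through N.

   From G to its powers: the relations read t ⊗ xh = (t ⊗ x)(t^x ⊗ h) and
   ts ⊗ g = (s ⊗ g^(lam t))(t ⊗ g), so modulo [S, S] the tensors t ⊗ n with n in
   N are bilinear, and modulo these so are all t ⊗ g.  If T and G are polycyclic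
   then S is therefore finitely generated, and a finitely generated central
   extension of a polycyclic group is polycyclic.  If T and G are finite then
   [S, S] is finite by Schur's theorem and bilinearity makes every t ⊗ g
   torsion, so S is finite by Dietzmann's lemma.

   From the n-th power to G: it maps onto the n-th term of the lower central
   series, whose quotients in G are finitely generated; this gives the polycyclic
   case.  If moreover the n-th power is finite then G / [G, G] is torsion, for
   otherwise G has a nonzero character phi into the integers and
   g_1 ⊗ ... ⊗ g_n |-> phi g_1 ... phi g_n has infinite image; hence all the
   lower central quotients are finite. *)
Require Import Defs.
From mathcomp Require Import all_boot all_classical.
From mathcomp Require Import ssralg ssrnum ssrint.

Set Implicit Arguments.
Unset Strict Implicit.
Unset Printing Implicit Defensive.

(** * Subgroups and subnormal series *)

Section Subgroups.
Local Open Scope classical_set_scope.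
Local Open Scope group_scope.
Variable G : groupType.
Implicit Types (A B D H K S M : set G) (x y z g h : G).

Section Closure.
Variables (A : set G) (sA : is_subgroup A).

Lemma sub1g : A 1. Proof. by case: sA. Qed.
Lemma subMg x y : A x -> A y -> A (x * y). Proof. by case: sA => _ + _; apply. Qed.
Lemma subVg x : A x -> A x^-1. Proof. by case: sA => _ _; apply. Qed.
Lemma subJg x y : A x -> A y -> A (x ^ y).
Proof. by move=> Ax Ay; rewrite conjgE; do !apply: subMg => //; exact: subVg. Qed.
Lemma subRg x y : A x -> A y -> A [~ x, y].
Proof. by move=> Ax Ay; apply: subMg; [exact: subVg|exact: subJg]. Qed.
Lemma subXg x n : A x -> A (x ^+ n).
Proof.
by move=> Ax; elim: n => [|n IH]; rewrite ?expgS; [exact: sub1g|exact: subMg].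
Qed.
Lemma subMgl x y : A x -> A (x * y) -> A y.
Proof. by move=> Ax Axy; rewrite -(mulKg x y); apply: subMg => //; exact: subVg. Qed.
Lemma subMgr x y : A y -> A (x * y) -> A x.
Proof. by move=> Ay Axy; rewrite -(mulgK y x); apply: subMg => //; exact: subVg. Qed.

End Closure.

Lemma is_subgroupT : is_subgroup [set: G]. Proof. by []. Qed.

Lemma is_subgroup1 : is_subgroup [set (1 : G)].
Proof. by split=> [|x y /= -> ->|x /= ->]; rewrite ?mulg1 ?invg1. Qed.

Lemma is_subgroupI A B :
  is_subgroup A -> is_subgroup B -> is_subgroup (A `&` B).
Proof.
move=> sA sB; split; first by split; exact: sub1g.
  by move=> x y [Ax Bx] [Ay By]; split; exact: subMg.
by move=> x [Ax Bx]; split; exact: subVg.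
Qed.

Lemma is_subgroup_generated A : is_subgroup (generated A).
Proof.
split=> [B [[]] //|x y Ax Ay B sB|x Ax B sB].
  by apply: subMg; [case: sB|exact: Ax|exact: Ay].
by apply: subVg; [case: sB|exact: Ax].
Qed.

Lemma sub_generated A : A `<=` generated A.
Proof. exact: sub_gen_smallest. Qed.

Lemma generated_sub A M : is_subgroup M -> A `<=` M -> generated A `<=` M.
Proof. exact: smallest_sub. Qed.

Lemma generated_id A : is_subgroup A -> generated A = A.
Proof. exact: smallest_id. Qed.

Lemma generatedS A B : A `<=` B -> generated A `<=` generated B.
Proof.
by move=> AB; apply: generated_sub (is_subgroup_generated _) _ => x /AB /sub_generated.
Qed.

Lemma generatedUl A B : generated (generated A `|` B) = generated (A `|` B).
Proof.
apply/seteqP; split; last first.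
  by apply: generatedS; apply: setSU; exact: sub_generated.
apply: generated_sub (is_subgroup_generated _) _ => x [|Bx].
  by apply: generatedS; exact: subsetUl.
by apply: sub_generated; right.
Qed.

Definition fg A := exists2 S : set G, finite_set S & A = generated S.

(** Both signs are required because in an infinite group the conjugate of [H] by [x] can be a proper
    subgroup of [H]. *)
Definition normalizes x H := forall h, H h -> H (h ^ x) /\ H (h ^ x^-1).

Lemma normalizesX x H n h : normalizes x H -> H h ->
  H (h ^ (x ^+ n)) /\ H (h ^ (x ^- n)).
Proof.
move=> nH; elim: n h => [|n IH] h Hh; first by rewrite invg1 !conjg1.
by rewrite -expVgn !expgSr !conjgM expVgn; case: (IH _ Hh) => /nH[? _] /nH[].
Qed.

(* Integer powers, with exponents given as differences n - m. *)
Definition zexp x n m := x ^+ n * x ^- m.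

Lemma zexpM x n m n' m' :
  zexp x n m * zexp x n' m' = zexp x (n + n') (m + m').
Proof.
have c : x ^- m * x ^+ n' = x ^+ n' * x ^- m.
  by apply/esym/commuteV/commuteX2.
by rewrite /zexp (addnC m) !expgnDr invgM -!mulgA; congr (_ * _); rewrite !mulgA c.
Qed.

Lemma zexpV x n m : (zexp x n m)^-1 = zexp x m n.
Proof. by rewrite /zexp invgM invgK. Qed.

Lemma zexpE x n m :
  zexp x n m = x ^+ (n - m) \/ zexp x n m = x ^- (m - n).
Proof.
case: (leqP m n) => [le|/ltnW le]; [left|right].
  by rewrite /zexp expgnFr.
by rewrite expgnFr // invgM invgK.
Qed.

Lemma normalizes_zexp x H n m h : normalizes x H -> H h -> H (h ^ zexp x n m).
Proof.
move=> nH Hh; rewrite conjgM.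
by have [_] := normalizesX m nH (normalizesX n nH Hh).1.
Qed.

Lemma sub_zexp A x n m : is_subgroup A -> A x -> A (zexp x n m).
Proof. by move=> sA Ax; apply: subMg => //; try apply: subVg => //; exact: subXg. Qed.

Definition adjoin H x := generated (H `|` [set x]).

Lemma adjoin_sub H x : H `<=` adjoin H x.
Proof. by move=> h Hh; apply: sub_generated; left. Qed.

Lemma adjoin_mem H x : adjoin H x x.
Proof. by apply: sub_generated; right. Qed.

Arguments adjoin_sub : clear implicits.
Arguments adjoin_mem : clear implicits.

Lemma is_subgroup_adjoin H x : is_subgroup (adjoin H x).
Proof. exact: is_subgroup_generated. Qed.

(** As [x] normalizes [H], powers of [x] move to the left past elements of [H], so the products of
    this shape already form a subgroup. *)
Lemma adjoinP H x y : is_subgroup H -> normalizes x H -> adjoin H x y ->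
  exists n m, exists2 h, H h & y = zexp x n m * h.
Proof.
move=> sH nH; pose B z := exists n m, exists2 h, H h & z = zexp x n m * h.
suff sB : is_subgroup B.
  apply: (generated_sub sB) => z [Hz|/= ->]; last first.
    by exists 1%N, 0, 1; rewrite /zexp ?invg1 ?mulg1 //; exact: sub1g.
  by exists 0, 0, z; rewrite /zexp ?invg1 ?mul1g.
split.
- by exists 0, 0, 1; rewrite /zexp ?invg1 ?mul1g //; exact: sub1g.
- move=> _ _ [n [m [h Hh ->]]] [n' [m' [h' Hh' ->]]].
  exists (n + n')%N, (m + m')%N, (h ^ zexp x n' m' * h').
    by apply: subMg => //; exact: normalizes_zexp.
  by rewrite -zexpM conjgE !gnorm.
move=> _ [n [m [h Hh ->]]]; exists m, n, (h^-1 ^ zexp x m n).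
  by apply: normalizes_zexp => //; exact: subVg.
by rewrite invgM zexpV conjgE mulVKg.
Qed.

Lemma normalizes_adjoin_normal H x :
  is_subgroup H -> normalizes x H -> is_normal_in H (adjoin H x).
Proof.
move=> sH nH; split=> //; [exact: is_subgroup_adjoin|exact: adjoin_sub|].
move=> h y Hh /(adjoinP sH nH)[n [m [k Hk ->]]].
by rewrite conjgM; apply: subJg => //; exact: normalizes_zexp.
Qed.

Lemma adjoin_cyclic H x : is_subgroup H -> normalizes x H ->
  has_cyclic_quotient H (adjoin H x).
Proof.
move=> sH nH; exists x; first exact: adjoin_mem.
move=> y /(adjoinP sH nH)[n [m [h Hh ->]]].
by case: (zexpE x n m) => ->; [exists (n - m)%N; left|exists (m - n)%N; right];
  rewrite mulKg.
Qed.

(** The exponent is the least positive one, by division with remainder; it is 0 when no positive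
    power of [x] lies in [A], and then only [n = 0] qualifies. *)
Lemma cyclic_exponent A x : is_subgroup A ->
  exists m, A (x ^+ m) /\ forall n, A (x ^+ n) -> exists q, n = (m * q)%N.
Proof.
move=> sA; case: (pselect (exists n, `[< (0 < n)%N /\ A (x ^+ n) >])) => [ex|nex].
  case: (ex_minnP ex) => m /asboolP[m0 Am] minm.
  exists m; split=> // n An; exists (n %/ m)%N.
  have An' : A (x ^+ (n %% m)).
    move: An; rewrite {1}(divn_eq n m) expgnDr; apply: subMgl => //.
    by rewrite mulnC expgnA; exact: subXg.
  have [r0|r0] := posnP (n %% m); first by rewrite {1}(divn_eq n m) r0 addn0 mulnC.
  have : (m <= n %% m)%N by apply: minm; apply/asboolP.
  by rewrite leqNgt ltn_mod m0.
exists 0; split; first exact: sub1g.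
move=> n An; exists 0; apply: contrapT => /eqP; rewrite muln0 -lt0n => n0.
by apply: nex; exists n; apply/asboolP.
Qed.

(** The top of a finite subnormal series with cyclic factors, in inductive form so that proofs can
    climb the series. *)
Inductive polyc : set G -> Prop :=
| polyc1 : polyc [set 1]
| polycS H K : polyc H -> is_normal_in H K -> has_cyclic_quotient H K -> polyc K.

Lemma polyc_subgroup A : polyc A -> is_subgroup A.
Proof. by elim=> [|H K _ _ []//]; exact: is_subgroup1. Qed.

Lemma polycyclicP : polycyclic G <-> polyc setT.
Proof.
split=> [[m [s [s0 sm st]]]|].
  rewrite -sm; have: (m <= m)%N by []; elim: {-2}m => [_|k IH km].
    by rewrite s0; exact: polyc1.
  by have [] := st k km; apply: polycS; apply: IH; exact: ltnW.
suff gen A : polyc A -> exists m s, [/\ s 0 = [set (1 : G)], s m = A &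
    forall i, (i < m)%N ->
    is_normal_in (s i) (s i.+1) /\ has_cyclic_quotient (s i) (s i.+1)].
  by move=> /gen.
elim=> [|H K _ [m [s [s0 sm st]]] nHK cHK].
  by exists 0, (fun=> [set 1]).
exists m.+1, (fun i => if (i <= m)%N then s i else K); split=> //.
- by rewrite ltnn.
- move=> i; rewrite /= ltnS leq_eqVlt => /orP[/eqP->|im].
    by rewrite eqxx ltnn sm.
  by rewrite im orbT; exact: st.
Qed.

Lemma polyc_adjoin H x : polyc H -> normalizes x H -> polyc (adjoin H x).
Proof.
move=> pH nH; have sH := polyc_subgroup pH.
by apply: (polycS pH); [exact: normalizes_adjoin_normal|exact: adjoin_cyclic].
Qed.

Lemma normal_normalizes H K x : is_normal_in H K -> K x -> normalizes x H.
Proof.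
by move=> [sH sK HK nHK] Kx h Hh; split; apply: nHK => //; exact: subVg.
Qed.

Lemma cyclic_quotient_adjoin H K : is_normal_in H K -> has_cyclic_quotient H K ->
  exists2 x, K x & K = adjoin H x.
Proof.
move=> nHK [x Kx cx]; case: (nHK) => sH sK HK _; exists x => //.
apply/seteqP; split=> [y /cx[n Hy]|]; last first.
  by apply: generated_sub => // y [/HK //|/= ->].
have sa := is_subgroup_adjoin H x; have ax := adjoin_mem H x.
have aX := subXg sa n ax.
by case: Hy => /(adjoin_sub H x); apply: (subMgl sa); do !apply: (subVg sa).
Qed.

(** A cyclic factor is generated by the coset of one element, so each step of a series adjoins a
    single normalizing element. *)
Lemma polyc_ind_adjoin (P : set G -> Prop) : P [set 1] ->
  (forall H x, polyc H -> normalizes x H -> P H -> P (adjoin H x)) ->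
  forall A, polyc A -> P A.
Proof.
move=> P1 Pa A; elim=> // H K pH IH nHK /(cyclic_quotient_adjoin nHK)[x Kx ->].
by apply: Pa => //; exact: normal_normalizes nHK Kx.
Qed.

Lemma generated1 : generated set0 = [set (1 : G)].
Proof.
apply/seteqP; split; first by apply: generated_sub is_subgroup1 _.
by move=> _ ->; apply: sub1g; exact: is_subgroup_generated.
Qed.

Lemma fg_adjoin H x : fg H -> fg (adjoin H x).
Proof.
move=> [S fS ->]; exists (S `|` [set x]); last by rewrite /adjoin generatedUl.
by rewrite finite_setU.
Qed.

Lemma polyc_fg A : polyc A -> fg A.
Proof.
elim/polyc_ind_adjoin=> [|H x _ _]; last exact: fg_adjoin.
by exists set0; rewrite ?generated1.
Qed.

(** Intersect the series with [A]. Each step of the intersection adjoins one element, since the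
    exponents of [x] that occur in [A] modulo [H] are the multiples of a single one. *)
Lemma polyc_sub L A : polyc L -> is_subgroup A -> polyc (A `&` L).
Proof.
move=> pL sA; elim/polyc_ind_adjoin: pL => [|H x pH nH IH].
  suff -> : A `&` [set 1] = [set 1] by exact: polyc1.
  by apply/seteqP; split=> [y []//|_ ->]; split=> //; exact: sub1g.
have sH := polyc_subgroup pH.
have nHK := normalizes_adjoin_normal sH nH.
have sK := is_subgroup_adjoin H x; set K := adjoin H x in nHK sK *.
(* [C] is the union of the cosets of [H] in [K] that meet [A]. Below, [m] generates the exponents of
   [x] in [C], and [h0] corrects [x ^+ m] to the element [x'] of [A]. *)
pose C y := K y /\ exists2 h, H h & A (y * h).
have sC : is_subgroup C.
  case: nHK => _ _ HK nHK; split.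
  - by split; [exact: sub1g|exists 1; rewrite ?mulg1; exact: sub1g].
  - move=> y z [Ky [h Hh Ah]] [Kz [k Hk Ak]]; split; first exact: (subMg sK).
    exists (h ^ z * k); first by apply: (subMg sH) => //; exact: nHK.
    suff -> : y * z * (h ^ z * k) = (y * h) * (z * k) by exact: subMg.
    by rewrite conjgE !gnorm.
  move=> y [Ky [h Hh Ah]]; split; first exact: (subVg sK).
  exists (h^-1 ^ y^-1); first by apply: nHK; [exact: (subVg sH)|exact: (subVg sK)].
  suff -> : y^-1 * h^-1 ^ y^-1 = (y * h)^-1 by exact: subVg.
  by rewrite conjgE !gnorm.
have [m [[Km [h0 Hh0 Am]] mP]] := cyclic_exponent x sC.
pose x' := x ^+ m * h0.
have Kx' : K x' by apply: (subMg sK) => //; exact: adjoin_sub.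
have nx' : normalizes x' (A `&` H).
  move=> y [Ay Hy]; have [] := normal_normalizes nHK Kx' Hy.
  by split; split=> //; apply: subJg => //; exact: subVg.
suff -> : A `&` K = adjoin (A `&` H) x' by exact: polyc_adjoin.
have sa := is_subgroup_adjoin (A `&` H) x'.
apply/seteqP; split; last first.
  apply: generated_sub; first exact: is_subgroupI.
  by move=> y [[Ay Hy]|/= ->//]; split=> //; exact: adjoin_sub.
have key n h : H h -> A (x ^+ n * h) -> adjoin (A `&` H) x' (x ^+ n * h).
  move=> Hh Anh.
  have [|q nq] := mP n; first by split; [by apply: (subXg sK); exact: adjoin_mem|exists h].
  (* Modulo [H] the elements [x'] and [x ^+ m] agree, so dividing by [x' ^+ q] leaves an element of
     [H]. *)
  have qx : H (x' ^- q * (x ^+ n * h)).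
    rewrite nq expgnA; have : H ((x ^+ m * h0) ^- q * (x ^+ m) ^+ q).
      elim: q {nq} => [|q IHq]; first by rewrite invg1 mulg1; exact: sub1g.
      rewrite expgSr (expgS (x ^+ m)) invgM.
      set u := x ^+ m; set v := u * h0; rewrite -/v in IHq.
      have -> : v^-1 * v ^- q * (u * u ^+ q) = v^-1 * v ^- q * (u ^+ q * u).
        by rewrite -expgS expgSr.
      rewrite mulgA -(mulgA v^-1) invgM.
      suff -> : h0^-1 * u^-1 * (v ^- q * u ^+ q) * u =
         h0^-1 * ((v ^- q * u ^+ q) ^ u).
        apply: subMg => //; first exact: subVg.
        by case: nHK => _ _ _; apply.
      by rewrite conjgE !gnorm.
    by rewrite mulgA => ?; exact: subMg.
  rewrite -(mulVKg (x' ^+ q) (x ^+ n * h)); apply: (subMg sa).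
    by apply: (subXg sa); exact: adjoin_mem.
  apply: adjoin_sub; split=> //; apply: (subMg sA) => //.
  by apply: (subVg sA); exact: subXg.
move=> y [Ay /(adjoinP sH nH)[n [k [h Hh ey]]]]; move: Ay; rewrite ey.
case: (zexpE x n k) => -> Ay; first exact: key.
(* Inverting makes a negative exponent positive and conjugates the factor from [H], so [key]
   applies. *)
rewrite -[X in adjoin _ _ X]invgK; apply: (subVg sa).
suff e : (x ^- (k - n) * h)^-1 = x ^+ (k - n) * h^-1 ^ (x ^+ (k - n)).
  rewrite e; apply: key; last by rewrite -e; exact: subVg.
  by have [] := normalizesX (k - n) nH (subVg sH Hh).
by rewrite conjgE !gnorm.
Qed.

End Subgroups.

Arguments adjoin_sub {G} H x [t].
Arguments adjoin_mem {G} H x.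

(** * Extensions with abelian kernel *)

Section AbelianExtension.
Local Open Scope classical_set_scope.
Local Open Scope group_scope.
Variable G : groupType.
Implicit Types (A B D H K S M : set G) (x y z g h : G).

Lemma normalizes_generated S x :
  (forall h, S h -> generated S (h ^ x) /\ generated S (h ^ x^-1)) ->
  normalizes x (generated S).
Proof.
have sS := is_subgroup_generated S.
move=> nS; pose B := [set h | generated S (h ^ x) /\ generated S (h ^ x^-1)].
have sB : is_subgroup B.
  split; first by split; rewrite conj1g; exact: (sub1g sS).
    move=> y z [y1 y2] [z1 z2]; rewrite /B /=.
    by rewrite !conjMg; split; exact: (subMg sS).
  by move=> y [y1 y2]; rewrite /B /= !conjVg; split; exact: (subVg sS).
by move=> h /(generated_sub sB); apply.
Qed.

(** [K / D] is abelian: the commutator condition makes every subgroup between [D] and [K] normal in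
    [K]. *)
Definition abelian_mod K D := [/\ is_subgroup K, is_subgroup D, D `<=` K &
  forall x y, K x -> K y -> D [~ x, y]].

(** A commutator depends only on its entries modulo the centre. The finite generation of the tensor
    product and Schur's theorem both rest on this. *)
Lemma commg_central (v k w l : G) :
  (forall x, k * x = x * k) -> (forall x, l * x = x * l) ->
  [~ v * k, w * l] = [~ v, w].
Proof.
move=> kC lC.
have e x y : [~ x, y] = (y * x)^-1 * (x * y) by rewrite commgEl conjgE !gnorm.
have -> : [~ v * k, w * l] = [~ v, w] ^ (k * l).
  have e1 : w * l * (v * k) = w * v * (k * l) by rewrite -mulgA lC !mulgA.
  have e2 : v * k * (w * l) = v * w * (k * l).
    by rewrite -!mulgA (mulgA k w) (kC w) !mulgA.
  by rewrite !e e1 e2 conjgE !gnorm.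
by rewrite conjgM !conjgE -kC mulKg -lC mulKg.
Qed.

Section AbelianMod.
Variables (K D : set G) (KD : abelian_mod K D).

Lemma abelian_mod_normalizes H x : is_subgroup H -> D `<=` H -> H `<=` K -> K x ->
  normalizes x H.
Proof.
case: KD => sK sD DK cK sH DH HK Kx h Hh.
have hx z : K z -> H (h ^ z).
  move=> Kz; rewrite -(mulVKg h (h ^ z)); apply: (subMg sH) => //.
  by apply/DH/cK => //; exact: HK.
by split; apply: hx => //; exact: subVg.
Qed.

(** The elements of [S] are adjoined one by one; each normalizes the subgroup built so far because
    that subgroup lies between [D] and [K]. *)
Lemma abelian_mod_adjoin_ind (P : set G -> Prop) S :
  finite_set S -> S `<=` K -> P D ->
  (forall H x, is_subgroup H -> D `<=` H -> K x -> normalizes x H -> P H ->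
     P (adjoin H x)) ->
  P (generated (D `|` S)).
Proof.
case: KD => sK sD DK _ /finite_seqP[s ->] + PD Pa.
elim: s => [_|x s IH sK']; first by rewrite set_nil setU0 generated_id.
have sub : [set` s] `<=` K by move=> y ys; apply: sK'; rewrite /= inE ys orbT.
have -> : generated (D `|` [set` x :: s]) = adjoin (generated (D `|` [set` s])) x.
  rewrite /adjoin generatedUl -setUA; congr (generated (_ `|` _)).
  apply/seteqP; split=> y /=; rewrite inE; first by case/predU1P; [right|left].
  by case=> ->; rewrite ?eqxx ?orbT.
have Kx : K x by apply: sK'; rewrite /= inE eqxx.
have DH : D `<=` generated (D `|` [set` s]).
  by move=> d Dd; apply: sub_generated; left.
have sH := is_subgroup_generated (D `|` [set` s]).
apply: Pa => //; last exact: IH.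
apply: abelian_mod_normalizes => //.
by apply: generated_sub => // y [/DK|/sub].
Qed.

Lemma abelian_mod_conj d x : D d -> K x -> D (d ^ x).
Proof.
case: KD => sK sD DK cK Dd Kx; rewrite -(mulVKg d (d ^ x)).
by apply: (subMg sD) => //; apply: cK => //; exact: DK.
Qed.

Lemma abelian_mod_expgM x y n : K x -> K y ->
  exists2 d, D d & (x * y) ^+ n = x ^+ n * y ^+ n * d.
Proof.
case: KD => sK sD DK cK Kx Ky; elim: n => [|n [d Dd IH]].
  by exists 1; rewrite ?mulg1 //; exact: sub1g.
exists ([~ y, x ^+ n] ^ (y ^+ n) * d).
  by apply: (subMg sD) => //; apply: abelian_mod_conj;
    [apply: cK => //|]; exact: (subXg sK).
by rewrite !expgS IH commgEl !conjgE !gnorm.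
Qed.

(** The preimage in [K] of the torsion subgroup of [K / D]. *)
Definition radical_mod := [set x | K x /\ exists2 n, (0 < n)%N & D (x ^+ n)].

Lemma is_subgroup_radical_mod : is_subgroup radical_mod.
Proof.
case: (KD) => sK sD DK cK; split.
- by split; [exact: sub1g|exists 1%N => //; exact: (sub1g sD)].
- move=> x y [Kx [n n0 Dx]] [Ky [m m0 Dy]]; split; first exact: subMg.
  exists (n * m)%N; first by rewrite muln_gt0 n0.
  have [d Dd ->] := abelian_mod_expgM (n * m) Kx Ky.
  apply: (subMg sD) => //; apply: (subMg sD).
    by rewrite expgnA; exact: (subXg sD).
  by rewrite mulnC expgnA; exact: (subXg sD).
- move=> x [Kx [n n0 Dx]]; split; first exact: subVg.
  by exists n => //; rewrite expVgn; exact: subVg.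
Qed.

Lemma sub_radical_mod : D `<=` radical_mod.
Proof. by case: KD => _ _ DK _ d Dd; split; [exact: DK|exists 1%N]. Qed.

Lemma radical_mod_root x n : (0 < n)%N -> K x -> radical_mod (x ^+ n) ->
  radical_mod x.
Proof.
move=> n0 Kx [_ [m m0 Dx]]; split=> //.
by exists (n * m)%N; rewrite ?muln_gt0 ?n0 // expgnA.
Qed.

End AbelianMod.
End AbelianExtension.

(** * Images and central preimages of polycyclic groups *)

Section Morphisms.
Local Open Scope classical_set_scope.
Local Open Scope group_scope.
Variables (J G : groupType) (f : J -> G).
Hypothesis fM : forall a b, f (a * b) = f a * f b.

Lemma is_subgroup_image (A : set J) : is_subgroup A -> is_subgroup (f @` A).
Proof.
move=> sA; split; first by exists 1; [exact: sub1g|exact: morph1].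
  by move=> _ _ [a Aa <-] [b Ab <-]; exists (a * b); [exact: subMg|exact: fM].
by move=> _ [a Aa <-]; exists a^-1; [exact: subVg|exact: morphV].
Qed.

Lemma is_subgroup_preimage (A : set G) : is_subgroup A -> is_subgroup (f @^-1` A).
Proof.
move=> sA; split=> /=; first by rewrite (morph1 fM); exact: sub1g.
  by move=> a b Aa Ab; rewrite /preimage /= fM; exact: subMg.
by move=> a Aa; rewrite /preimage /= (morphV fM); exact: subVg.
Qed.

Lemma generated_image (S : set J) : f @` generated S = generated (f @` S).
Proof.
apply/seteqP; split; last first.
  apply: generated_sub; first exact: is_subgroup_image (is_subgroup_generated _).
  by move=> _ [s Ss <-]; exists s => //; exact: sub_generated.
move=> _ [a Sa <-]; move: a Sa.
apply: (generated_sub (is_subgroup_preimage (is_subgroup_generated (f @` S)))).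
by move=> s Ss; apply: sub_generated; exists s.
Qed.

Lemma adjoin_image (H : set J) x : is_subgroup H ->
  f @` adjoin H x = adjoin (f @` H) (f x).
Proof. by move=> sH; rewrite /adjoin generated_image image_setU image_set1. Qed.

Lemma polyc_image (A : set J) : polyc A -> polyc (f @` A).
Proof.
elim/polyc_ind_adjoin => [|H x pH nH IH].
  by rewrite image_set1 (morph1 fM); exact: polyc1.
rewrite adjoin_image; last exact: polyc_subgroup.
apply: polyc_adjoin => // _ [h Hh <-]; have [h1 h2] := nH h Hh.
by split; [exists (h ^ x)|exists (h ^ x^-1)];
  rewrite // (morphJ fM) ?(morphV fM).
Qed.

Hypothesis fC : forall a b, f a = 1 -> a * b = b * a.

(* By induction on a series of A = <H, x>: if the preimage of A is finitely
   generated then so is that of H, because H is finitely generated modulo the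
   central kernel and only finitely many kernel elements are needed to describe
   the conjugation by x and the generators of the preimage of A. *)
Lemma polyc_central_preimage (A : set G) : polyc A -> A `<=` range f ->
  fg (f @^-1` A) -> polyc (f @^-1` A).
Proof.
elim/polyc_ind_adjoin => [_ [S fS eS]|H xb pH nH IH Af [S fS eS]].
  (* In the base case the preimage is the kernel, a finitely generated abelian group. *)
  have sK : is_subgroup (f @^-1` [set 1]).
    by apply: is_subgroup_preimage; exact: is_subgroup1.
  have KD : abelian_mod (f @^-1` [set 1]) [set 1].
    split=> //; first exact: is_subgroup1.
      by move=> _ -> /=; exact: morph1.
    move=> x y fx _ /=.
    by rewrite commgEl conjgE (fC y fx) mulKg mulVg.
  have -> : f @^-1` [set 1] = generated ([set 1] `|` S).
    rewrite eS; apply/seteqP; split; first by apply: generatedS; exact: subsetUr.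
    apply: generated_sub; first exact: is_subgroup_generated.
    move=> y [->|]; last exact: sub_generated.
    exact: sub1g (is_subgroup_generated S).
  apply: (abelian_mod_adjoin_ind KD) => //; last by move=> *; exact: polyc_adjoin.
    by rewrite eS; exact: sub_generated.
  exact: polyc1.
have sH := polyc_subgroup pH.
have [x _ fx] := Af _ (adjoin_mem H xb); rewrite -fx in nH Af eS *.
set J1 := f @^-1` H; set J2 := f @^-1` adjoin H (f x) in eS *.
have s1 : is_subgroup J1 by exact: is_subgroup_preimage.
have s2 : is_subgroup J2 by exact: is_subgroup_preimage (is_subgroup_adjoin _ _).
have J12 : J1 `<=` J2 by move=> v Hv; exact: adjoin_sub.
have n1 : normalizes x J1.
  move=> h /nH[h1 h2]; rewrite /J1 /preimage /=.
  by rewrite !(morphJ fM) (morphV fM).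
have [Y fY eY] := polyc_fg pH.
have /choice[r rP] y : exists z, adjoin H (f x) y -> f z = y.
  have [Hy|nHy] := pselect (adjoin H (f x) y); last by exists 1.
  by have [z _ fz] := Af _ Hy; exists z.
pose Y' := r @` Y; pose W := generated Y'.
have sW : is_subgroup W by exact: is_subgroup_generated.
have YH y : Y y -> H y by rewrite eY; exact: sub_generated.
have rY y : Y y -> f (r y) = y by move=> /YH Hy; rewrite rP //; exact: adjoin_sub.
have Y'1 : Y' `<=` J1 by move=> _ [y Yy <-]; rewrite /J1 /preimage /= rY //; exact: YH.
have fW : f @` W = H.
  rewrite generated_image [RHS]eY; congr generated; apply/seteqP; split=> [_ [_ [y Yy <-] <-]|y Yy].
    by rewrite rY.
  by exists (r y); [exists y|exact: rY].
(* Every [v] in [J1] is an element of [W], which maps onto [H], times a kernel element [kap v]. *)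
have /choice[kap kapP] v : exists k, J1 v -> f k = 1 /\ W (v * k^-1).
  have [Hv|nHv] := pselect (J1 v); last by exists 1.
  have [w Ww fw] : (f @` W) (f v) by rewrite fW.
  exists (w^-1 * v) => _; split.
    by rewrite fM (morphV fM) fw mulVg.
  by rewrite invgM invgK mulVKg.
(* [tau s] is the factor from [J1] that remains after splitting off a power of [x]. *)
have /choice[tau tauP] s : exists t, J2 s ->
    J1 t /\ exists n m, s = zexp x n m * t.
  have [Hs|nHs] := pselect (J2 s); last by exists 1.
  have [n [m [h Hh fs]]] := adjoinP sH nH Hs.
  exists ((zexp x n m)^-1 * s) => _; split; last by exists n, m; rewrite mulVKg.
  rewrite /J1 /preimage /= fM fs (morphV fM).
  suff -> : f (zexp x n m) = zexp (f x) n m by rewrite mulKg.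
  have fX k : f (x ^+ k) = f x ^+ k.
    by elim: k => [|k IHk]; rewrite ?(morph1 fM) // !expgS fM IHk.
  by rewrite /zexp fM (morphV fM) !fX.
have [m [Jm mP]] := cyclic_exponent x s1.
(* These generators make [L] contain lifts of the generators of [H], be normalized by [x], generate
   [J2] together with [x], and contain every power of [x] that lies in [J1]. This forces [L] to be
   [J1]. *)
pose F := Y' `|` ((fun y => kap (y ^ x)) @` Y' `|`
  ((fun y => kap (y ^ x^-1)) @` Y' `|` ((fun s => kap (tau s)) @` S `|` [set x ^+ m]))).
pose L := generated F.
have sL : is_subgroup L by exact: is_subgroup_generated.
have FL : F `<=` L by exact: sub_generated.
have WL : W `<=` L by apply: generatedS; exact: subsetUl.
have kL v : J1 v -> L (kap v) -> L v.
  move=> Jv Lk; have [_ /WL] := kapP v Jv.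
  by apply: (subMgr sL); exact: (subVg sL).
have kJ v : f v = 1 -> J1 v by move=> fv; rewrite /J1 /preimage /= fv; exact: sub1g.
have yx y : Y' y -> J1 (y ^ x) /\ J1 (y ^ x^-1) by move=> /Y'1/n1.
have SJ2 : S `<=` J2 by rewrite eS; exact: sub_generated.
have L1 : L `<=` J1.
  apply: generated_sub => // _ [/Y'1//|[[y Yy <-]|[[y Yy <-]|[[s Ss <-]|->//]]]].
  - by apply/kJ; have [] := kapP _ (yx _ Yy).1.
  - by apply/kJ; have [] := kapP _ (yx _ Yy).2.
  - by apply/kJ; have [] := kapP _ (tauP _ (SJ2 _ Ss)).1.
have kx v : f v = 1 -> v ^ x = v /\ v ^ x^-1 = v.
  by move=> fv; rewrite !conjgE !(fC _ fv) !mulKg.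
have nL : normalizes x L.
  apply: normalizes_generated => h Fh.
  have Lh := FL _ Fh; rewrite -/L.
  case: Fh => [Yh|[[y Yy e]|[[y Yy e]|[[s Ss e]|e]]]].
  - split; apply: kL; rewrite ?(yx _ Yh).1 ?(yx _ Yh).2 //.
    + by have [] := yx _ Yh.
    + by apply: FL; right; left; exists h.
    + by have [] := yx _ Yh.
    + by apply: FL; right; right; left; exists h.
  - by have [] := kapP _ (yx _ Yy).1; rewrite e => /kx[-> ->].
  - by have [] := kapP _ (yx _ Yy).2; rewrite e => /kx[-> ->].
  - by have [] := kapP _ (tauP _ (SJ2 _ Ss)).1; rewrite e => /kx[-> ->].
  - have c : commute (x ^+ m) x by apply: commute_sym; apply: commuteX.
    have c' := commuteV c.
    by move: Lh; rewrite e !conjgE c c' mulKg mulKg.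
have sa := is_subgroup_adjoin L x.
have J2L : J2 `<=` adjoin L x.
  rewrite eS; apply: generated_sub => // s Ss.
  have [Jt [n [k ->]]] := tauP _ (SJ2 _ Ss).
  apply: (subMg sa); first by apply: (sub_zexp _ _ sa); exact: adjoin_mem.
  apply: adjoin_sub; apply: kL => //; apply: FL; do 3 right; left.
  by exists s.
(* An element of [J1] is a power of [x] times an element of [L]; that power then lies in [J1], so it
   is a power of [x ^+ m]. *)
have J1L : J1 = L.
  apply/seteqP; split=> // v Jv.
  have [n [k [l Ll e]]] := adjoinP sL nL (J2L _ (J12 _ Jv)).
  rewrite e; apply: (subMg sL) => //.
  have : J1 (zexp x n k) by apply: (subMgr s1) (L1 _ Ll) _; rewrite -e.
  have Lm : L (x ^+ m) by apply: FL; do 4 right.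
  case: (zexpE x n k) => ->.
    by move=> /mP[q ->]; rewrite expgnA; exact: (subXg sL).
  move=> /(subVg s1); rewrite invgK => /mP[q ->]; rewrite expgnA.
  by apply: (subVg sL); exact: (subXg sL).
have p1 : polyc J1.
  apply: IH; first by move=> h Hh; apply: Af; exact: adjoin_sub.
  exists F => //; rewrite !finite_setU; split; first exact: finite_image.
  by do !split; try exact: finite_set1; do 2?apply: finite_image.
suff -> : J2 = adjoin J1 x by exact: polyc_adjoin.
apply/seteqP; split; first by rewrite J1L.
apply: generated_sub => // v [/J12//|/= ->]; exact: adjoin_mem.
Qed.

End Morphisms.

(** * Generation of T ⊗ G *)

Section TensorStep.
Local Open Scope classical_set_scope.
Local Open Scope group_scope.
Variables (G : groupType) (T : power_datum G).
Notation S := (tensor (step_actions T)).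
Notation tns := (tens (step_actions T)).
Notation lam := (@pd_map G T).
Notation act := (@pd_act G T).
Notation N := (range (@step_map G T)).
Implicit Types (s t : T) (g h x : G) (a b : S).

(** Writing [t * s] as [s ^ t^-1 * t] before applying the defining relation frees its left entry
    from conjugation; [tens_mul_right] does the same for the right entry. *)
Lemma tens_mul_left t s g : tns (t * s) g = tns s (g ^ lam t) * tns t g.
Proof. by rewrite (conjgCV t s) tensMl /= -conjgM mulVg conjg1. Qed.

Lemma tens_mul_right t x h : tns t (x * h) = tns t x * tns (act t x) h.
Proof. by rewrite (conjgCV x h) tensMr /= -conjgM mulVg conjg1. Qed.

(** An element of [N] acts on [S] as conjugation by any of its preimages, so here the twist is inner
    and vanishes modulo commutators. *)
Lemma tens_mul_right_image t h b :
  tns t (h * step_map b) = tns t (step_map b) * tns t h ^ b.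
Proof. by rewrite tensMr -step_act_tens step_act_map. Qed.

Lemma tens1r t : tns t 1 = 1.
Proof.
have [a1 _ _] := pd_action T.
by have := tens_mul_right t 1 1; rewrite mulg1 a1 -{1}(mulg1 (tns t 1)) => /mulgI.
Qed.

Lemma tens1l g : tns 1 g = 1.
Proof.
have := tens_mul_left 1 1 g.
by rewrite mulg1 (morph1 (@pd_mapM _ T)) conjg1 -{1}(mulg1 (tns 1 g)) => /mulgI.
Qed.

Lemma is_subgroup_step_image : is_subgroup N.
Proof. exact: (is_subgroup_image (@step_mapM _ T) (is_subgroupT _)). Qed.

Lemma step_image_normal n x : N n -> N (n ^ x).
Proof. by move=> [a _ <-]; exists (step_act a x) => //; exact: step_map_act. Qed.

Lemma step_image_commg t g : N [~ lam t, g].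
Proof. by exists (tns t g) => //; exact: step_map_tens. Qed.

Lemma conjg_pd_map t g : exists2 n, N n & g ^ lam t = g * n.
Proof.
exists [~ g, lam t]; last by rewrite commgEl mulVKg.
by rewrite -invgR; apply: (subVg is_subgroup_step_image); exact: step_image_commg.
Qed.

(** * From generators to all pure tensors, modulo a subgroup containing the commutators *)

Section Saturation.
Variables (M : set S) (sM : is_subgroup M) (cM : forall a b, M [~ a, b]).

Lemma saturated_conj a b : M (a ^ b) <-> M a.
Proof.
have e : a ^ b = a * [~ a, b] by rewrite commgEl mulVKg.
rewrite e; split=> [|Ma]; last exact: (subMg sM).
exact: (subMgr sM).
Qed.

Variables (Y : set T) (X Z : set G).
Hypothesis (YT : generated Y = setT) (XG : generated X = setT).
Hypothesis ZN : generated Z = N.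
Hypothesis MX : forall t x, Y t -> X x -> M (tns t x).
Hypothesis MZ : forall t z, Y t -> Z z -> M (tns t z).

(** Modulo [M] the conjugation by [b] disappears, so the right entry is multiplicative on [N] and
    the generators [Z] suffice. *)
Lemma saturated_gen_image t n : Y t -> N n -> M (tns t n).
Proof.
move=> Yt Nn; pose B := [set n | N n /\ M (tns t n)].
suff sB : is_subgroup B.
  have ZB : Z `<=` B.
    by move=> z Zz; split; [rewrite -ZN; exact: sub_generated|exact: MZ].
  by move: Nn; rewrite -ZN => /(generated_sub sB ZB)[].
split.
- by split; [exact: (sub1g is_subgroup_step_image)|rewrite tens1r; exact: (sub1g sM)].
- move=> x y [Nx Mx] [Ny My]; split; first exact: (subMg is_subgroup_step_image).
  case: Ny My => b _ <- Mb; rewrite tens_mul_right_image; apply: (subMg sM) => //.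
  exact/saturated_conj.
- move=> x [Nx Mx]; split; first exact: (subVg is_subgroup_step_image).
  case: Nx Mx => b _ <- Mb.
  apply/(saturated_conj _ b); apply: (subMgl sM Mb).
  by rewrite -tens_mul_right_image mulVg tens1r; exact: (sub1g sM).
Qed.

(** [N] is normal in [G], so quantifying over all of [N] absorbs the conjugation in
    [tens_mul_left]. *)
Lemma saturated_image t n : N n -> M (tns t n).
Proof.
pose B := [set t | forall n, N n -> M (tns t n)].
suff sB : is_subgroup B.
  have YB : Y `<=` B by move=> s Ys m; exact: saturated_gen_image.
  have : generated Y t by rewrite YT.
  by move=> /(generated_sub sB YB); apply.
split.
- by move=> m _; rewrite tens1l; exact: (sub1g sM).
- move=> s u Bs Bu m Nm; rewrite tens_mul_left; apply: (subMg sM); last exact: Bs.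
  by apply: Bu; exact: step_image_normal.
- move=> s Bs m Nm.
  have Nm' : N (m ^ lam s^-1) by exact: step_image_normal.
  have -> : m = (m ^ lam s^-1) ^ lam s.
    by rewrite (morphV (@pd_mapM _ T)) -conjgM mulVg conjg1.
  apply: (subMgr sM) (Bs _ Nm') _.
  by rewrite -tens_mul_left mulgV tens1l; exact: (sub1g sM).
Qed.

(** Conjugation by [lam t] multiplies [g] by an element of [N], and tensors with right entry in [N]
    are already in [M]. Hence the left entry is multiplicative modulo [M]. *)
Lemma saturated_conj_right s t g : M (tns s (g ^ lam t)) <-> M (tns s g).
Proof.
have [n Nn ->] := conjg_pd_map t g; rewrite tens_mul_right.
have Ms : M (tns (act s g) n) by exact: saturated_image.
by split=> [|Mg]; [exact: (subMgr sM)|exact: (subMg sM)].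
Qed.

Lemma saturated_gen t x : X x -> M (tns t x).
Proof.
move=> Xx; pose B := [set t | M (tns t x)].
suff sB : is_subgroup B.
  have YB : Y `<=` B by move=> s Ys; exact: MX.
  have : generated Y t by rewrite YT.
  exact: (generated_sub sB YB).
split.
- by rewrite /B /= tens1l; exact: (sub1g sM).
- move=> s u Bs Bu; rewrite /B /= tens_mul_left; apply: (subMg sM) => //.
  exact/saturated_conj_right.
- move=> s Bs; apply/(saturated_conj_right _ s); apply: (subMgr sM Bs).
  by rewrite -tens_mul_left mulgV tens1l; exact: (sub1g sM).
Qed.

(** Quantifying over all left entries absorbs the action of [x] on [t] in [tens_mul_right]. *)
Lemma saturated_tens t g : M (tns t g).
Proof.
pose B := [set g | forall t, M (tns t g)].
suff sB : is_subgroup B.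
  have XB : X `<=` B by move=> x Xx s; exact: saturated_gen.
  have : generated X g by rewrite XG.
  by move=> /(generated_sub sB XB); apply.
have [a1 aM _] := pd_action T.
split.
- by move=> s; rewrite tens1r; exact: (sub1g sM).
- by move=> x h Bx Bh s; rewrite tens_mul_right; apply: (subMg sM); [exact: Bx|exact: Bh].
- move=> x Bx s; rewrite -[s]a1 -(mulVg x) aM.
  apply: (subMgl sM (Bx (act s x^-1))).
  by rewrite -tens_mul_right mulgV tens1r; exact: (sub1g sM).
Qed.

End Saturation.

Lemma tensor_subgroup_full (M : set S) : is_subgroup M ->
  (forall t g, M (tns t g)) -> M = setT.
Proof.
move=> sM MS; apply/seteqP; split=> // a _.
elim/tensor_ind: a => [|t g a Ma|t g a Ma]; first exact: (sub1g sM).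
  exact: (subMg sM).
by apply: (subMg sM) => //; exact: (subVg sM).
Qed.

Lemma step_map_kernel_central a b : step_map a = 1 -> a * b = b * a.
Proof.
move=> ka; rewrite [RHS]conjgC -step_act_map ka.
by have [-> _ _] := step_action T.
Qed.

(* The kernel being central, the commutators of S lie in every subgroup that
   maps onto N, such as the one generated by F below. *)
Lemma tensor_fg : fg [set: T] -> fg [set: G] -> fg N -> fg [set: S].
Proof.
move=> [Y fY /esym YT] [X fX /esym XG] [Z fZ /esym ZN].
have /choice[r rP] n : exists a, N n -> step_map a = n.
  have [[a _ <-]|nN] := pselect (N n); last by exists 1.
  by exists a.
pose F := [set tns t h | t in Y & h in X `|` Z] `|` r @` Z.
have fF : finite_set F.
  rewrite finite_setU; split; last exact: finite_image.
  by apply: finite_image2 => //; rewrite finite_setU.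
exists F => //; pose M := generated F.
have sM : is_subgroup M by exact: is_subgroup_generated.
have NM : N `<=` @step_map _ T @` M.
  rewrite -ZN; apply: generated_sub; first exact: (is_subgroup_image (@step_mapM _ T) sM).
  move=> z Zz; exists (r z); first by apply: sub_generated; right; exists z.
  by apply: rP; rewrite -ZN; exact: sub_generated.
have split_ker a : exists2 w, M w & exists2 k, step_map k = 1 & a = w * k.
  have [|w Mw e] := NM (step_map a); first by exists a.
  exists w => //; exists (w^-1 * a); last by rewrite mulVKg.
  by rewrite step_mapM (morphV (@step_mapM _ T)) e mulVg.
have cM a b : M [~ a, b].
  have [v Mv [k k1 ->]] := split_ker a; have [w Mw [l l1 ->]] := split_ker b.
  by rewrite commg_central; [exact: (subRg sM)|move=> c; exact: step_map_kernel_central..].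
apply/esym; apply: tensor_subgroup_full => //; apply: (saturated_tens sM cM YT XG ZN).
  by move=> t x Yt Xx; apply: sub_generated; left; exists t => //; exists x => //; left.
by move=> t z Yt Zz; apply: sub_generated; left; exists t => //; exists z => //; right.
Qed.

Lemma tensor_polyc : polyc [set: T] -> polyc [set: G] -> polyc [set: S].
Proof.
move=> pT pG.
have pN : polyc N.
  by have := polyc_sub pG is_subgroup_step_image; rewrite setIT.
have := polyc_central_preimage (@step_mapM _ T) step_map_kernel_central pN.
have -> : @step_map _ T @^-1` N = setT by apply/seteqP; split=> // a _; exists a.
by apply=> //; apply: tensor_fg; exact: polyc_fg.
Qed.

End TensorStep.

(** * Finiteness of T ⊗ G *)

Section FiniteGeneration.
Local Open Scope classical_set_scope.
Local Open Scope group_scope.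
Variable G : groupType.
Implicit Types (s w : seq G) (a b c d g x y : G).

Definition wprod w : G := foldr *%g 1 w.

Lemma wprod_cat w w' : wprod (w ++ w') = wprod w * wprod w'.
Proof. by elim: w => [|x w IH] /=; rewrite ?mul1g // IH mulgA. Qed.

Lemma wprod_nseq n x : wprod (nseq n x) = x ^+ n.
Proof. by elim: n => //= n ->; rewrite expgS. Qed.

Lemma size_le_count s w p : {subset w <= s} ->
  (forall c, c \in s -> count_mem c w <= p)%N -> (size w <= p * size s)%N.
Proof.
elim: s w => [|c s IH] w ws cw.
  by case: w ws {cw} => [|x w] // /(_ x); rewrite inE eqxx => /(_ isT).
rewrite -(count_predC (pred1 c) w) mulnS; apply: leq_add.
  by apply: cw; rewrite inE eqxx.
rewrite -size_filter; apply: IH => [x|d ds].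
  rewrite mem_filter /= => /andP[xc /ws]; rewrite inE; case/predU1P => // e.
  by rewrite e eqxx in xc.
apply: leq_trans (cw d _); last by rewrite inE ds orbT.
by rewrite count_filter; apply: sub_count => x /andP[].
Qed.

Section ConjugationClosed.
Variables (s : seq G) (p : nat).
Hypothesis sJ : forall c d, c \in s -> d \in s -> d ^ c \in s.

(** The letters passed over are replaced by conjugates, which stay in the alphabet, so the length is
    preserved. *)
Lemma gather c w k : c \in s -> {subset w <= s} -> (k <= count_mem c w)%N ->
  exists w', [/\ {subset w' <= s}, size w = (k + size w')%N
    & wprod w = c ^+ k * wprod w'].
Proof.
move=> cs; elim: w k => [|d w IH] k ws.
  by rewrite /= leqn0 => /eqP->; exists [::]; split=> //=; rewrite mulg1.
have ws' : {subset w <= s} by move=> x xw; apply: ws; rewrite inE xw orbT.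
have ds : d \in s by apply: ws; rewrite inE eqxx.
rewrite /=; have [->|ne] := eqVneq d c.
  case: k => [_|k kw]; first by exists (c :: w); rewrite mul1g; split=> // x /predU1P[->|/ws'].
  have [w' [w's e1 e2]] := IH k ws' kw.
  by exists w'; split=> //; rewrite ?e1 // e2 expgS mulgA.
rewrite add0n => kw; have [w' [w's e1 e2]] := IH k ws' kw.
exists (d ^ (c ^+ k) :: w'); split=> //=.
- move=> x /predU1P[->|/w's//].
  elim: k {IH kw e1 e2} => [|k IHk]; first by rewrite conjg1.
  by rewrite expgSr conjgM; exact: sJ.
- by rewrite e1 addnS.
by rewrite e2 mulgA (conjgC d) -mulgA.
Qed.

Hypothesis sX : forall c, c \in s ->
  exists w, [/\ {subset w <= s}, (size w <= p)%N & c ^+ p.+1 = wprod w].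

(* Among more than p |s| letters one occurs p + 1 times; gathering these
   occurrences in front by conjugation and rewriting their product shortens the
   word (this covers both Dietzmann's lemma and Schur's theorem). *)
Lemma shorten w : {subset w <= s} ->
  exists w', [/\ {subset w' <= s}, (size w' <= p * size s)%N & wprod w' = wprod w].
Proof.
have [n] := ubnP (size w); elim: n w => // n IH w lew ws.
have [small|big] := leqP (size w) (p * size s); first by exists w.
have [c cs pc] : exists2 c, c \in s & (p.+1 <= count_mem c w)%N.
  apply: contrapT => nc; move: big; rewrite ltnNge => /negP; apply.
  by apply: size_le_count => // c cs; rewrite leqNgt; apply/negP => pc; apply: nc; exists c.
have [w' [w's e1 e2]] := gather cs ws pc.
have [u [us up ue]] := sX cs.
have [|x|v [vs vp ve]] := IH (u ++ w').
- rewrite size_cat; apply: leq_ltn_trans (leq_add up (leqnn _)) _.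
  by move: lew; rewrite e1 ltnS.
- by rewrite mem_cat => /orP[/us|/w's].
by exists v; split=> //; rewrite ve wprod_cat e2 ue.
Qed.

Lemma finite_words : finite_set [set wprod w | w in [set w | {subset w <= s}]].
Proof.
pose W n := [set wprod w | w in [set w | {subset w <= s} /\ (size w <= n)%N]].
suff fW n : finite_set (W n).
  apply: sub_finite_set (fW (p * size s)%N) => _ [w ws <-].
  by have [w' [w's le e]] := shorten ws; exists w'.
elim: n => [|n IH].
  apply: sub_finite_set (finite_set1 1) => x [w []] _.
  by rewrite leqn0 => /nilP-> <-.
apply: (@sub_finite_set _ _ ([set 1] `|` [set c * x | c in [set` s] & x in W n])).
  move=> _ [[|c w] [ws wn] <-]; [by left|right].
  exists c; first by apply: ws; rewrite inE eqxx.
  exists (wprod w) => //; exists w => //; split=> //.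
  by move=> x xw; apply: ws; rewrite inE xw orbT.
by rewrite finite_setU; split; [exact: finite_set1|exact: finite_image2].
Qed.

End ConjugationClosed.

Lemma expg_finite (A : set G) g : finite_set A -> (forall n, A (g ^+ n)) ->
  exists2 n, (0 < n)%N & g ^+ n = 1.
Proof.
move=> fA Ag; apply: contrapT => ng.
have inj : injective (fun n => g ^+ n).
  move=> i j; wlog ij : i j / (i <= j)%N.
    by move=> W e; case/orP: (leq_total i j) => /W wij; [|apply: esym]; apply: wij.
  move=> e; apply/eqP; rewrite eqn_leq ij leqNgt; apply/negP => lt; apply: ng.
  by exists (j - i)%N; rewrite ?subn_gt0 // expgnFr // e mulgV.
apply: infinite_nat.
have -> : [set: nat] = (fun n => g ^+ n) @^-1` A by apply/esym/seteqP; split=> // n _; exact: Ag.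
by apply: finite_preimage => // i j _ _; exact: inj.
Qed.

Lemma exponent_seq s : (forall g, g \in s -> exists2 n, (0 < n)%N & g ^+ n = 1) ->
  exists2 m, (0 < m)%N & forall g, g \in s -> g ^+ m = 1.
Proof.
elim: s => [|x s IH] sX; first by exists 1%N.
have [m m0 mP] : exists2 m, (0 < m)%N & forall g, g \in s -> g ^+ m = 1.
  by apply: IH => g gs; apply: sX; rewrite inE gs orbT.
have [|n n0 xn] := sX x; first by rewrite inE eqxx.
exists (n * m)%N; first by rewrite muln_gt0 n0.
move=> g /predU1P[->|/mP gm]; first by rewrite expgnA xn expg1n.
by rewrite mulnC expgnA gm expg1n.
Qed.

Lemma exponent_finite : finite_set [set: G] ->
  exists2 m, (0 < m)%N & forall g, g ^+ m = 1.
Proof.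
move=> fG; have /finite_seqP[s es] := fG.
have [|m m0 mP] := @exponent_seq s.
  by move=> g _; apply: (expg_finite fG).
exists m => // g; apply: mP.
by have : [set: G] g by []; rewrite es.
Qed.

(** The computation behind Schur's theorem: the central power [[~ a, b] ^+ m.+1] slides to the left
    past the last letter [b] of the remaining factor [[~ a, b]], and the power [m.+2] becomes a
    product of [m.+1] commutators. *)
Lemma schur_word a b m : (forall x, commute ([~ a, b] ^+ m.+1) x) ->
  [~ a, b] ^+ m.+2 = [~ a, b ^+ 2] * [~ a ^ b, b] ^+ m.
Proof.
move=> cz; have -> : [~ a ^ b, b] = [~ a, b] ^ b by rewrite conjRg (conjgE b b) mulKg.
rewrite -conjXg.
have E u : [~ a, b ^+ 2] * u ^ b = a^-1 * b^-1 * a * ([~ a, b] * u) * b.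
  by rewrite !commgEl !conjgE expg2 !gnorm.
rewrite E -(expgS _ m) (expgS _ m.+1); move: (_ ^+ m.+1) cz => z cz.
by rewrite -(mulgA _ z) cz mulgA commgEl conjgE !gnorm.
Qed.

End FiniteGeneration.

(** * Schur's theorem on commutators *)

Section Schur.
Local Open Scope classical_set_scope.
Local Open Scope group_scope.
Variables (J G : groupType) (f : J -> G).
Hypothesis fM : forall a b, f (a * b) = f a * f b.
Hypothesis fC : forall a b, f a = 1 -> a * b = b * a.

(** The kernel is central, so there are only finitely many commutators. They are closed under
    conjugation, and [schur_word] shortens their high powers, so their products form a finite
    set. *)
Lemma finite_commutators : finite_set [set: G] ->
  exists D : set J, [/\ is_subgroup D, finite_set D & forall a b, D [~ a, b]].
Proof.
move=> fG; have [[//|m] m0 mP] := exponent_finite fG.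
have /choice[r rP] y : exists a, range f y -> f a = y.
  have [[a _ <-]|ny] := pselect (range f y); last by exists 1.
  by exists a.
have /finite_seqP[s es] :
  finite_set [set [~ r x, r y] | x in [set: G] & y in [set: G]].
  exact: finite_image2.
have sR a b : [~ a, b] \in s.
  suff : [set` s] [~ a, b] by [].
  rewrite -es; exists (f a) => //; exists (f b) => //.
  have ker c : f ((r (f c))^-1 * c) = 1.
    by rewrite fM (morphV fM) rP ?mulVg //; exists c.
  rewrite -[in RHS](mulVKg (r (f a)) a) -[in RHS](mulVKg (r (f b)) b).
  by rewrite commg_central // => x; apply: fC; exact: ker.
have sP c : c \in s -> exists a b, c = [~ a, b].
  move=> cs; have : [set` s] c by [].
  by rewrite -es => -[x _ [y _ <-]]; exists (r x), (r y).
exists [set wprod w | w in [set w : seq J | {subset w <= s}]]; split.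
- split; first by exists [::].
    move=> _ _ [u us <-] [w ws <-]; exists (u ++ w); last exact: wprod_cat.
    by move=> x; rewrite mem_cat => /orP[/us|/ws].
  move=> _ [w ws <-]; elim: w ws => [|c w IH] ws.
    by exists [::] => //; rewrite invg1.
  have [|u us e] := IH; first by move=> x xw; apply: ws; rewrite inE xw orbT.
  have [a [b ec]] : exists a b, c = [~ a, b] by apply: sP; apply: ws; rewrite inE eqxx.
  exists (u ++ [:: [~ b, a]]).
    by move=> x; rewrite mem_cat => /orP[/us//|]; rewrite inE => /eqP->.
  by rewrite wprod_cat e /= mulg1 invgM ec invgR.
- apply: (@finite_words _ s m.+1) => [c d _|c].
    by move=> /sP[a [b ->]]; rewrite conjRg.
  move=> /sP[a [b ->]].
  exists ([~ a, b ^+ 2] :: nseq m [~ a ^ b, b]); split.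
  + by move=> x /predU1P[->//|/nseqP[->]].
  + by rewrite /= size_nseq.
  rewrite /= wprod_nseq; apply: schur_word => x; apply: fC.
  have fX z n : f (z ^+ n) = f z ^+ n.
    by elim: n => [|n IH]; rewrite ?(morph1 fM) // !expgS fM IH.
  by rewrite fX mP.
- by move=> a b; exists [:: [~ a, b]]; [move=> x; rewrite inE => /eqP->|rewrite /= mulg1].
Qed.

End Schur.

(** * Torsion of pure tensors and finiteness *)

Section FiniteTensor.
Local Open Scope classical_set_scope.
Local Open Scope group_scope.
Variables (G : groupType) (T : power_datum G).
Notation S := (tensor (step_actions T)).
Notation tns := (tens (step_actions T)).
Notation lam := (@pd_map G T).
Notation act := (@pd_act G T).
Notation N := (range (@step_map G T)).
Implicit Types (s t : T) (g h x : G) (a b : S).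

Lemma tens_torsion (D : set S) : finite_set [set: T] -> finite_set [set: G] ->
  is_subgroup D -> (forall a b, D [~ a, b]) ->
  forall t g, exists2 n, (0 < n)%N & D (tns t g ^+ n).
Proof.
move=> fT fG sD cD t g.
have [m m0 Gm] := exponent_finite fG; have [l l0 Tl] := exponent_finite fT.
have KD : abelian_mod setT D by split=> //; exact: is_subgroupT.
pose M := radical_mod setT D.
have sM : is_subgroup M by exact: is_subgroup_radical_mod.
have DM : D `<=` M by exact: sub_radical_mod.
have cM a b : M [~ a, b] by apply: DM.
(* First stage: modulo [D] the right entry is multiplicative on [N], so the exponent [m] of [G]
   kills these tensors. *)
have MN u n : N n -> M (tns u n).
  move=> Nn; apply: (radical_mod_root m0) => //; apply: DM.
  suff [d Dd] : exists2 d, D d & tns u (n ^+ m) = tns u n ^+ m * d.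
    rewrite Gm tens1r => e; apply: (subMgr sD Dd); rewrite -e; exact: (sub1g sD).
  elim: m {m0 Gm} => [|k [d Dd IH]].
    by exists 1; rewrite ?tens1r ?mulg1 //; exact: (sub1g sD).
  have [b _ eb] := subXg (is_subgroup_step_image T) k Nn.
  exists (d ^ tns u n * [~ tns u n, b]).
    by apply: (subMg sD) => //; exact: (abelian_mod_conj KD).
  rewrite expgS -eb tens_mul_right_image eb IH expgSr.
  by rewrite commgEl !conjgE !gnorm.
suff [_ //] : M (tns t g).
(* Second stage: modulo the radical [M], which contains the tensors of the first stage, the left
   entry is multiplicative, and the exponent [l] of [T] applies. *)
apply: (radical_mod_root l0) => //.
suff [d Md] : exists2 d, M d & tns (t ^+ l) g = tns t g ^+ l * d.
  rewrite Tl tens1l => e; apply: (subMgr sM Md); rewrite -e; exact: (sub1g sM).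
elim: l {l0 Tl} => [|k [d Md IH]].
  by exists 1; rewrite ?tens1l ?mulg1 //; exact: (sub1g sM).
have [n Nn eg] := conjg_pd_map (t ^+ k) g.
exists ((tns (act t g) n) ^ (tns t g ^+ k) * d).
  by apply: (subMg sM) => //; apply/(saturated_conj sM cM); exact: MN.
rewrite expgSr tens_mul_left eg tens_mul_right IH expgS.
by rewrite !conjgE !gnorm.
Qed.

Lemma tensor_finite : finite_set [set: T] -> finite_set [set: G] ->
  finite_set [set: S].
Proof.
move=> fT fG.
have [D [sD fD cD]] := finite_commutators (@step_mapM _ T) (@step_map_kernel_central _ T) fG.
have /finite_seqP[s es] : finite_set [set tns t g | t in [set: T] & g in [set: G]].
  exact: finite_image2.
have sR t g : tns t g \in s.
  suff : [set` s] (tns t g) by [].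
  by rewrite -es; exists t => //; exists g.
have sP c : c \in s -> exists t g, c = tns t g.
  move=> cs; have : [set` s] c by [].
  by rewrite -es => -[t _ [g _ <-]]; exists t, g.
have [[//|e] _ eP] : exists2 e, (0 < e)%N & forall c, c \in s -> c ^+ e = 1.
  apply: exponent_seq => c /sP[t [g ->]].
  have [n n0 Dn] := tens_torsion fT fG sD cD t g.
  have [k k0 ek] := expg_finite fD (fun k => subXg sD k Dn).
  by exists (n * k)%N; rewrite ?muln_gt0 ?n0 // expgnA.
apply: (@sub_finite_set _ _ [set wprod w | w in [set w : seq S | {subset w <= s}]]).
  move=> a _; elim/tensor_ind: a => [|t g a [w ws ew]|t g a [w ws ew]].
  - by exists [::].
  - by exists (tns t g :: w); [move=> x /predU1P[->|/ws]|rewrite /= ew].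
  (* As [e.+1] kills every letter, the inverse of a letter is its power [e]. *)
  - exists (nseq e (tns t g) ++ w).
      by move=> x; rewrite mem_cat => /orP[/nseqP[->]|/ws].
    rewrite wprod_cat wprod_nseq ew; congr (_ * _).
    by apply: (mulgI (tns t g)); rewrite -expgS mulgV eP.
(* [S] acts on itself through [N], so a conjugate of a pure tensor is pure; the power [e.+1] of a
   letter shortens to the empty word. *)
apply: (@finite_words _ s e) => [c d _|c].
  move=> /sP[t [g ->]].
  by rewrite -step_act_map step_act_tens.
by move=> cs; exists [::]; split=> //; exact: eP.
Qed.

End FiniteTensor.

(** * Lower central series and characters *)

Section Descent.
Local Open Scope classical_set_scope.
Local Open Scope group_scope.
Variable G : groupType.
Implicit Types (A B C D H K S M X Y : set G) (x y z g h : G).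

Lemma commgMr x y z : [~ x, y * z] = [~ x, z] * [~ x, y] ^ z.
Proof. by rewrite !commgEl !conjgE !gnorm. Qed.

Lemma commgMl x y z : [~ x * y, z] = [~ x, z] ^ y * [~ y, z].
Proof. by rewrite !commgEl !conjgE !gnorm. Qed.

(** Modulo [M] the elements of [B] are central, so [[~ c, g]] is multiplicative in both entries and
    can be tested on generators. It is meant for consecutive terms [A] and [B] of the lower central
    series. *)
Lemma commutators_generated A B M X Y :
  generated X = setT -> A `<=` generated (B `|` Y) -> Y `<=` A -> B `<=` A ->
  is_subgroup M -> (forall c g, A c -> B [~ c, g]) ->
  (forall d g, B d -> M [~ d, g]) ->
  (forall y x, Y y -> X x -> M [~ y, x]) ->
  is_subgroup A ->
  forall c g, A c -> M [~ c, g].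
Proof.
move=> XG AY YA BA sM AB BM YX sA.
have MJ d g : B d -> (M (d ^ g) <-> M d).
  move=> Bd; have e : d ^ g = d * [~ d, g] by rewrite commgEl mulVKg.
  rewrite e; have ? := BM d g Bd; split; first exact: (subMgr sM).
  by move=> ?; exact: (subMg sM).
have YM y g : Y y -> M [~ y, g].
  move=> Yy; pose L := [set g | M [~ y, g]].
  suff sL : is_subgroup L.
    have XL : X `<=` L by move=> x Xx; exact: YX.
    have : generated X g by rewrite XG.
    exact: (generated_sub sL XL).
  split; first by rewrite /L /= commg1; exact: (sub1g sM).
    move=> u v Lu Lv; rewrite /L /= commgMr; apply: (subMg sM) => //.
    by apply/MJ => //; apply: AB; exact: YA.
  move=> u Lu; rewrite /L /=.
  have : M [~ y, u * u^-1] by rewrite mulgV commg1; exact: (sub1g sM).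
  by rewrite commgMr; apply: (subMgr sM); apply/MJ => //; apply: AB; exact: YA.
pose L := [set c | A c /\ forall g, M [~ c, g]].
suff sL : is_subgroup L.
  have BYL : B `|` Y `<=` L.
    by move=> d [Bd|Yd]; split=> [|g]; [exact: BA|exact: BM|exact: YA|exact: YM].
  by move=> c g /AY /(generated_sub sL BYL)[_]; apply.
split.
- by split=> [|g]; [exact: sub1g|rewrite comm1g; exact: (sub1g sM)].
- move=> c d [Ac Mc] [Ad Md]; split=> [|g]; first exact: subMg.
  by rewrite commgMl; apply: (subMg sM) => //; apply/MJ => //; exact: AB.
- move=> c [Ac Mc]; split=> [|g]; first exact: subVg.
  have : M [~ c * c^-1, g] by rewrite mulgV comm1g; exact: (sub1g sM).
  by rewrite commgMl; apply: (subMgl sM); apply/MJ => //; exact: AB.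
Qed.

(** Modulo [C] the commutator [[~ c, g]] commutes with [c], so [[~ c ^+ n, g]] is its power [n]. *)
Lemma commg_radical B C c g n : abelian_mod B C -> (0 < n)%N ->
  B [~ c, g] -> (forall b, B b -> C [~ b, c]) -> C [~ c ^+ n, g] ->
  radical_mod B C [~ c, g].
Proof.
move=> BC n0 Bc cC Cn; have [sB sC CB _] := BC; split=> //; exists n => //.
suff [d Cd e] : exists2 d, C d & [~ c ^+ n, g] = [~ c, g] ^+ n * d.
  by apply: (subMgr sC Cd); rewrite -e.
elim: n {n0 Cn} => [|n [d Cd IH]].
  by exists 1; rewrite ?comm1g ?mulg1 //; exact: sub1g.
pose u := [~ c, g] ^+ n * d.
have Bu : B u by apply: (subMg sB); [exact: subXg|exact: CB].
exists ((d * [~ u, c]) ^ [~ c, g]).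
  by apply: (abelian_mod_conj BC) => //; apply: (subMg sC) => //; exact: cC.
rewrite expgSr commgMl IH -/u.
have -> : u ^ c = u * [~ u, c] by rewrite commgEl mulVKg.
by rewrite {1}/u expgSr; move: [~ u, c] => v; rewrite !conjgE !gnorm.
Qed.

Lemma finite_adjoin H x n : is_subgroup H -> normalizes x H -> (0 < n)%N ->
  H (x ^+ n) -> finite_set H -> finite_set (adjoin H x).
Proof.
move=> sH nH n0 Hn fH.
apply: (@sub_finite_set _ _ [set x ^+ i * h | i in `I_n & h in H]); last first.
  by apply: finite_image2 => //; exact: finite_II.
have pow k h : H h -> [set x ^+ i * h | i in `I_n & h in H] (x ^+ k * h).
  move=> Hh; exists (k %% n)%N; first by rewrite /= ltn_mod.
  exists (x ^+ n ^+ (k %/ n) * h); first by apply: (subMg sH) => //; exact: subXg.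
  by rewrite mulgA -expgnA -expgnDr {3}(divn_eq k n) addnC mulnC.
move=> y /(adjoinP sH nH)[i [j [h Hh ->]]].
case: (zexpE x i j) => ->; first exact: pow.
set k := (j - i)%N.
(* Multiplying by [x ^+ (n * k)] makes the exponent nonnegative, since [n] is positive; the
   correction lies in [H]. *)
have -> : x ^- k * h = x ^+ (n * k - k) * ((x ^+ n) ^- k * h).
  rewrite expgnFr ?leq_pmull // mulgA expgnA; congr (_ * _).
  have c : commute (x ^+ k) (x ^+ n ^+ k) by rewrite -expgnA; apply: commuteX2.
  by rewrite (commuteV (commute_sym c)) mulgK.
by apply: pow; apply: (subMg sH) => //; apply: subVg => //; exact: subXg.
Qed.

End Descent.

(** * Integer-valued characters *)

Section Characters.
Local Open Scope classical_set_scope.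
Local Open Scope group_scope.
Variable G : groupType.
Implicit Types (D H S : set G) (x y z g h d : G).

Definition character_on H D (phi : G -> int) :=
  [/\ forall x y, H x -> H y -> phi (x * y) = (phi x + phi y)%R,
      forall d, D d -> phi d = 0%R & exists2 x, H x & phi x <> 0%R].

(** A finitely generated abelian group is torsion or has a nonzero homomorphism to the integers.
    Generators are adjoined one at a time, according to whether a positive power of the new one lies
    in [H]. *)
Lemma character_or_torsion D S : abelian_mod setT D -> finite_set S ->
  let H := generated (D `|` S) in
  (exists phi, character_on H D phi) \/
  (forall x, H x -> exists2 n, (0 < n)%N & D (x ^+ n)).
Proof.
move=> TD fS H; pose P H := (exists phi, character_on H D phi) \/
  (forall x, H x -> exists2 n, (0 < n)%N & D (x ^+ n)).
apply: (abelian_mod_adjoin_ind TD (P := P)) => //.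
  by right=> x Dx; exists 1%N.
move=> {S fS}{}H x sH DH _ nH PH.
have [sT sD _ cD] := TD.
have sA := is_subgroup_adjoin H x.
have [[m m0 Hm]|nm] := pselect (exists2 m, (0 < m)%N & H (x ^+ m)).
  have AH y : adjoin H x y -> H (y ^+ m).
    pose L := [set y | H (y ^+ m)].
    suff sL : is_subgroup L.
      have HL : H `|` [set x] `<=` L by move=> z [Hz|->//]; exact: subXg.
      exact: (generated_sub sL HL).
    split; first by rewrite /L /= expg1n; exact: sub1g.
      move=> y1 y2 H1 H2; rewrite /L /=.
      have [//|//|d Dd ->] := abelian_mod_expgM TD (x := y1) (y := y2) m.
      by apply: (subMg sH); [exact: subMg|exact: DH].
    by move=> y1 H1; rewrite /L /= expVgn; exact: subVg.
  case: PH => [[phi [pM pD [z Hz pz]]]|tH]; [left|right]; last first.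
    move=> y /AH/tH[n n0 Dn]; exists (m * n)%N; rewrite ?muln_gt0 ?m0 //.
    by rewrite expgnA.
  have pX y n : H y -> phi (y ^+ n) = (phi y *+ n)%R.
    move=> Hy; elim: n => [|n IH]; first by rewrite pD //; exact: (sub1g sD).
    by rewrite expgS pM ?IH ?GRing.mulrS //; exact: subXg.
  (* The power map [m] sends [adjoin H x] into [H] and is multiplicative modulo [D], on which [phi]
     vanishes. *)
  exists (fun y => phi (y ^+ m)); split.
  - move=> y1 y2 /AH H1 /AH H2.
    have [//|//|d Dd ->] := abelian_mod_expgM TD (x := y1) (y := y2) m.
    rewrite pM //; last exact: DH; last exact: subMg.
    by rewrite pM // (pD d) // GRing.addr0.
  - by move=> d Dd; apply: pD; exact: subXg.
  - exists z; first exact: adjoin_sub.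
    rewrite pX // => /eqP; rewrite Num.Theory.mulrn_eq0.
    by case/orP => [/eqP e|/eqP//]; rewrite e in m0.
left.
(* No positive power of [x] lies in [H], so the exponent of [x] is well defined modulo [H] and is
   the character; [p] records it as a difference. *)
have /choice[p pP] y : exists p : nat * nat, adjoin H x y ->
    exists2 h, H h & y = zexp x p.1 p.2 * h.
  have [Ay|nA] := pselect (adjoin H x y); last by exists (0, 0).
  by have [i [j [h Hh e]]] := adjoinP sH nH Ay; exists (i, j) => _; exists h.
have z0 i j : H (zexp x i j) -> i = j.
  move=> Hz; apply/eqP; apply: contrapT => /negP; rewrite neq_ltn => /orP[ij|ij];
    apply: nm; [exists (j - i)%N|exists (i - j)%N]; rewrite ?subn_gt0 //.
    by move: (subVg sH Hz); rewrite zexpV /zexp expgnFr // ltnW.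
  by move: Hz; rewrite /zexp expgnFr // ltnW.
pose phi y := ((p y).1%:Z - (p y).2%:Z)%R.
have uniq i j h : H h -> phi (zexp x i j * h) = (i%:Z - j%:Z)%R.
  move=> Hh; set y := _ * h.
  have Ay : adjoin H x y.
    apply: (subMg sA); last exact: adjoin_sub.
    by apply: (sub_zexp _ _ sA); exact: adjoin_mem.
  have [k Hk e] := pP y Ay; rewrite /phi.
  have : H (zexp x ((p y).2 + i) ((p y).1 + j)).
    rewrite -zexpM -(zexpV x (p y).1).
    apply: (subMgr sH Hh); rewrite -mulgA -/y [X in _ * X]e mulKg //.
  move=> /z0 e'; apply/eqP; rewrite GRing.subr_eq GRing.addrAC eq_sym GRing.subr_eq.
  by rewrite -!PoszD addnC e'.
exists phi; split.
- move=> y1 y2 A1 A2; have [h1 H1 e1] := pP _ A1; have [h2 H2 e2] := pP _ A2.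
  rewrite {1}e1 {1}e2.
  set i1 := (p y1).1; set j1 := (p y1).2; set i2 := (p y2).1; set j2 := (p y2).2.
  have -> : zexp x i1 j1 * h1 * (zexp x i2 j2 * h2) =
    zexp x (i1 + i2) (j1 + j2) * (h1 ^ zexp x i2 j2 * h2).
    by rewrite -zexpM conjgE !gnorm.
  rewrite uniq; last by apply: (subMg sH) => //; exact: normalizes_zexp.
  by rewrite !PoszD GRing.opprD GRing.addrACA.
- move=> d /DH Hd; have := uniq 0 0 d Hd.
  by rewrite /zexp invg1 !mul1g GRing.subrr.
- exists x; first exact: adjoin_mem.
  have := uniq 1%N 0 1 (sub1g sH).
  by rewrite /zexp invg1 !mulg1 => ->.
Qed.

End Characters.

(** * The lower central series and the descent to [G] *)

Section LowerCentral.
Local Open Scope classical_set_scope.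
Local Open Scope group_scope.
Variable G : groupType.
Implicit Types (x y z g h d : G).

(** The lower central series counted from 0, so that [lcs 0] is [G], as images of the commutator
    maps. *)
Definition lcs k := range (@pd_map G (tpow_succ G k)).

Lemma lcs0 : lcs 0 = setT.
Proof. by apply/seteqP; split=> // x _; exists x. Qed.

Lemma is_subgroup_lcs k : is_subgroup (lcs k).
Proof. exact: (is_subgroup_image (@pd_mapM _ _) (is_subgroupT _)). Qed.

Lemma lcs_comm k x g : lcs k x -> lcs k.+1 [~ x, g].
Proof. by move=> [t _ <-]; exact: step_image_commg. Qed.

Lemma lcsS_sub k (M : set G) : is_subgroup M ->
  (forall x g, lcs k x -> M [~ x, g]) -> lcs k.+1 `<=` M.
Proof.
move=> sM cM _ [a _ <-]; rewrite /=.
have cM' t g : M (step_map (tens (step_actions (tpow_succ G k)) t g)).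
  by rewrite step_map_tens; apply: cM; exists t.
elim/tensor_ind: a => [|t g a IH|t g a IH].
- by rewrite (morph1 (@step_mapM _ _)); exact: sub1g.
- by rewrite step_mapM; exact: subMg.
by rewrite step_mapM (morphV (@step_mapM _ _)); apply: subMg => //; exact: subVg.
Qed.

Lemma lcsS k : lcs k.+1 `<=` lcs k.
Proof.
have sL := is_subgroup_lcs k.
apply: lcsS_sub => // x g [t _ <-]; rewrite commgEl; apply: (subMg sL).
  by apply: (subVg sL); exists t.
by exists (pd_act t g) => //; exact: pd_map_act.
Qed.

Lemma abelian_mod_lcs k : abelian_mod (lcs k) (lcs k.+1).
Proof.
split; [exact: is_subgroup_lcs|exact: is_subgroup_lcs|exact: lcsS|].
by move=> x y Lx _; exact: lcs_comm.
Qed.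

(** By induction, commutators of the generators chosen for [lcs k] modulo [lcs k.+1] with generators
    of [G] generate the next term modulo the one after. *)
Lemma lcs_fg_mod k : fg [set: G] -> exists S, [/\ finite_set S, S `<=` lcs k
  & lcs k = generated (lcs k.+1 `|` S)].
Proof.
move=> [X fX XG]; elim: k => [|k [Y [fY YL eL]]].
  exists X; split=> //; first by rewrite lcs0.
  rewrite lcs0; apply/seteqP; split=> // x; rewrite XG.
  by apply: generatedS; exact: subsetUr.
pose S := [set [~ y, x] | y in Y & x in X].
have SL : S `<=` lcs k.+1 by move=> _ [y /YL Ly [x _ <-]]; exact: lcs_comm.
exists S; split=> //; first exact: finite_image2.
have sM := is_subgroup_generated (lcs k.+2 `|` S).
apply/seteqP; split; last first.
  by apply: generated_sub; [exact: is_subgroup_lcs|move=> x [/lcsS|/SL]].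
apply: lcsS_sub => //.
apply: (commutators_generated (B := lcs k.+1) (esym XG) _ YL) => //.
- by rewrite {1}eL.
- exact: lcsS.
- by move=> c g; exact: lcs_comm.
- by move=> d g Ld; apply: sub_generated; left; exact: lcs_comm.
- by move=> y x Yy Xx; apply: sub_generated; right; exists y => //; exists x.
- exact: is_subgroup_lcs.
Qed.

(** Climb from [lcs k] back to [G]: each factor is finitely generated abelian, so finitely many
    adjunctions cross it. *)
Lemma lcs_polyc k : fg [set: G] -> polyc (lcs k) -> polyc [set: G].
Proof.
move=> fG; elim: k => [|k IH]; first by rewrite lcs0.
move=> pL; apply: IH; have [S [fS SL ->]] := lcs_fg_mod k fG.
apply: (abelian_mod_adjoin_ind (abelian_mod_lcs k)) => //.
by move=> H x _ _ _; move/[swap]; exact: polyc_adjoin.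
Qed.

(** Torsion passes down the series because commutators with a fixed [g] turn powers into powers
    modulo the following term. *)
Lemma lcs_torsion k : (forall x, exists2 n, (0 < n)%N & lcs 1 (x ^+ n)) ->
  lcs k `<=` radical_mod (lcs k) (lcs k.+1).
Proof.
move=> tG; elim: k => [|k IH].
  move=> x _; have [n n0 Ln] := tG x.
  by split; [rewrite lcs0|exists n].
have K := abelian_mod_lcs k.+1.
apply: lcsS_sub; first exact: is_subgroup_radical_mod.
move=> x g Lx; have [_ [n n0 Ln]] := IH x Lx.
apply: (commg_radical K n0); first exact: lcs_comm.
  by move=> b; exact: lcs_comm.
exact: lcs_comm.
Qed.

Lemma lcs_finite k : fg [set: G] ->
  (forall x, exists2 n, (0 < n)%N & lcs 1 (x ^+ n)) ->
  finite_set (lcs k) -> finite_set [set: G].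
Proof.
move=> fG tG; elim: k => [|k IH]; first by rewrite lcs0.
move=> fL; apply: IH; have [S [fS SL ->]] := lcs_fg_mod k fG.
apply: (abelian_mod_adjoin_ind (abelian_mod_lcs k)) => //.
move=> H x sH LH /(lcs_torsion tG)[_ [n n0 Ln]] nH.
by apply: (finite_adjoin sH nH n0); exact: LH.
Qed.

Definition invariant_character (T : power_datum G) (psi : T -> int) :=
  [/\ forall s t, psi (s * t) = (psi s + psi t)%R,
      forall t x, psi (pd_act t x) = psi t & exists t, psi t <> 0%R].

(** The character sends [tens t g] to [psi t * phi g]. Invariance of [psi] and [phi] makes the
    relations hold, and the integers have no zero divisors, so it is nonzero. *)
Lemma tensor_character (T : power_datum G) (psi : T -> int) (phi : G -> int) :
  (forall x y, phi (x * y) = (phi x + phi y)%R) -> (exists x, phi x <> 0%R) ->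
  invariant_character psi -> exists chi, @invariant_character (pd_step T) chi.
Proof.
move=> phiM [g0 phi0] [psiM psiA [t0 psi0]].
(* The additive group of integers in multiplicative form, as a target for [tensor_lift]. *)
pose Z : groupType := Algebra.to_multiplicative int.
have phi1 : phi 1 = 0%R by exact: (morph1 (K := Z) phiM).
have phiV x : phi x^-1 = (- phi x)%R by exact: (morphV (K := Z) phiM).
have phiJ x y : phi (x ^ y) = phi x.
  by rewrite conjgE !phiM phiV GRing.addrC GRing.addrK.
pose f (t : T) (g : G) : Z := (psi t * phi g)%R.
have psiJ t s : psi (t ^ s) = psi t by rewrite -pd_act_map.
have fl t s g : f (t * s) g = f (t ^ s) (actr (step_actions T) g s) * f s g.
  by rewrite /f /= psiM phiJ psiJ GRing.mulrDl.
have fr t g h : f t (g * h) = f t h * f (actl (step_actions T) t h) (g ^ h).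
  by rewrite /f /= phiM phiJ psiA GRing.mulrDr [RHS]GRing.addrC.
pose chi : tensor (step_actions T) -> Z := tensor_lift f.
have chiM a b : chi (a * b) = chi a * chi b by exact: (tensor_liftM fl fr).
have chiE t g : chi (tens _ t g) = f t g by exact: (tensor_lift_tens fl fr).
exists chi; split => //.
- move=> a x; apply: (@step_ext G T Z (fun a => chi (step_act a x)) chi) => //.
    by move=> b c; rewrite step_actMl chiM.
  by move=> t g; rewrite step_act_tens !chiE /f psiA phiJ.
exists (tens (step_actions T) t0 g0); rewrite chiE /f => /eqP.
by rewrite GRing.mulf_eq0 => /orP[] /eqP.
Qed.

Lemma tensor_power_character (phi : G -> int) k :
  (forall x y, phi (x * y) = (phi x + phi y)%R) -> (exists x, phi x <> 0%R) ->
  exists psi, @invariant_character (tpow_succ G k) psi.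
Proof.
move=> phiM phi0; elim: k => [|k [psi ic]]; last exact: tensor_character ic.
exists phi; split=> // x y.
have phiV z : phi z^-1 = (- phi z)%R.
  exact: (morphV (K := Algebra.to_multiplicative int) phiM).
by rewrite /= conjgE !phiM phiV GRing.addrC GRing.addrK.
Qed.

(** A nonzero character of [G] would induce one on the tensor power, but a finite group has none. *)
Lemma tensor_power_finite_torsion k : fg [set: G] ->
  finite_set [set: tpow_succ G k] ->
  forall x, exists2 n, (0 < n)%N & lcs 1 (x ^+ n).
Proof.
move=> fG fT.
have [S [fS SL eS]] := lcs_fg_mod 0 fG.
have KD : abelian_mod setT (lcs 1) by rewrite -lcs0; exact: abelian_mod_lcs.
have [] := character_or_torsion KD fS; rewrite -eS lcs0; last by move=> + x; apply.
move=> [phi [phiM _ [g _ phig]]].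
have [||psi [psiM _ [t psit]]] := @tensor_power_character phi k.
- by move=> x y; exact: phiM.
- by exists g.
have [n n0 tn] := expg_finite (g := t) fT (fun _ => I).
have psi1 : psi 1 = 0%R.
  exact: (morph1 (K := Algebra.to_multiplicative int) psiM).
have psiX m : psi (t ^+ m) = (psi t *+ m)%R.
  by elim: m => [|m IH]; rewrite // expgS psiM IH GRing.mulrS.
case: psit; apply/eqP; move/eqP: psi1.
by rewrite -tn psiX Num.Theory.mulrn_eq0 (gtn_eqF n0).
Qed.

End LowerCentral.

(** * Both equivalences for tensor powers *)

Lemma tpow_polyc (G : groupType) k :
  polyc [set: G]%classic -> polyc [set: tpow_succ G k]%classic.
Proof. by move=> pG; elim: k => [//|k IH]; exact: tensor_polyc. Qed.

Lemma tpow_finite (G : groupType) k :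
  finite_set [set: G]%classic -> finite_set [set: tpow_succ G k]%classic.
Proof. by move=> fG; elim: k => [//|k IH]; exact: tensor_finite. Qed.

Local Open Scope classical_set_scope.

Theorem theorem1p2 (n : nat) (hn : 2 <= n) (G : groupType)
    (hG : finitely_generated G) :
  (finite_set [set: tensor_power G n] <-> finite_set [set: G]) /\
  (polycyclic (tensor_power G n) <-> polycyclic G).
Proof.
have fG : fg [set: G] by have [S fS eS] := hG; exists S.
rewrite !polycyclicP /tensor_power; split; split; last exact: tpow_polyc.
(* [lcs n.-1] is the image of the tensor power under its commutator map, so it inherits finiteness,
   and below polycyclicity, before the climb to [G]. *)
- move=> fT; apply: (lcs_finite (k := n.-1) fG); last exact: finite_image.
  exact: tensor_power_finite_torsion fG fT.
- exact: tpow_finite.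
- move=> pT; apply: (lcs_polyc (k := n.-1) fG).
  exact: (polyc_image (@pd_mapM _ _) pT).
Qed.
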